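(* Let $M^n$ be the minimal isoparametric hypersurface of OT-FKM type in the unit sphere $S^{n+1}(1)$ (associated with a symmetric Clifford system $\{P_0,\dots,P_m\}$ on $\mathbb{R}^{2l}$, $n=2l-2$). Then there exist three eigenfunctions $\varphi_1,\varphi_2,\varphi_3: M^n\to\mathbb{R}$ of the Laplacian of $M^n$, corresponding to the eigenvalues $n$, $2n$ and $3n$ respectively, whose critical sets consist of $8$ points, a submanifold, and $8$ points, respectively. More specifically, $\varphi_1$ and $\varphi_3$ are both Morse functions, and $\varphi_2$ is an isoparametric function on $M^n$ whose critical set $C(\varphi_2)$ is $$C(\varphi_2)=N_+\cup N_-,\qquad \dim N_+=\dim N_-=n-m\quad (1\le m<n),$$ where $N_+$ and $N_-$ are the focal submanifolds of $\varphi_2$ on $M^n$.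
   Context: A symmetric Clifford system on $\mathbb{R}^{2l}$ is a set $\{P_0,\dots,P_m\}$ of real symmetric $2l\times 2l$ matrices with $P_iP_j+P_jP_i=2\delta_{ij}I_{2l}$ for all $0\le i,j\le m$. Standing assumptions: $m>0$ and $l-m-1>0$. Put $$F:\mathbb{R}^{2l}\to\mathbb{R},\qquad F(x)=|x|^4-2\sum_{\alpha=0}^m\langle P_\alpha x,x\rangle^2,\qquad f:=F|_{S^{2l-1}(1)},$$ and $n+1=2l-1$, so $S^{n+1}(1)=S^{2l-1}(1)$. The isoparametric hypersurfaces of OT-FKM type are the level hypersurfaces $f^{-1}(c)$, $-1<c<1$. There is a unique $c_0\in(-1,1)$ such that $f^{-1}(c_0)$ is a minimal hypersurface of $S^{n+1}(1)$, and $M^n:=f^{-1}(c_0)$, with the induced metric, is called the minimal isoparametric hypersurface of OT-FKM type. The Laplacian is $\Delta u=\mathrm{div}\,\nabla u$; a nonzero function $u$ is an eigenfunction with eigenvalue $\lambda$ if $\Delta u+\lambda u=0$. A non-constant smooth function $u$ on a Riemannian manifold is isoparametric if $|\nabla u|^2=b(u)$ and $\Delta u=a(u)$ for some smooth function $b$ and continuous function $a$ on $\mathbb{R}$. The focal submanifolds (focal varieties) of $u$ are the preimages of its global maximum and global minimum values; for $\varphi_2$ these are denoted $N_+$ and $N_-$ respectively. $C(u)$ denotes the set of critical points of $u$. *)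

(* Defs.v *)
From HB Require Import structures.
From mathcomp Require Import all_boot all_order all_algebra.
From mathcomp Require Import all_classical all_reals all_analysis.

Set Implicit Arguments.
Unset Strict Implicit.
Unset Printing Implicit Defensive.

Import Order.TTheory GRing.Theory Num.Theory.
Import numFieldNormedType.Exports.

Local Open Scope classical_set_scope.
Local Open Scope ring_scope.

(* The norm carried by 'rV[R]_N in the library is the sup norm; it is only used
   for the topology and for differentiation.  The Euclidean metric is dotp. *)
Definition dotp (R : realType) (N : nat) (u v : 'rV[R]_N) : R :=
  \sum_(i < N) u 0 i * v 0 i.

Definition unit_sphere (R : realType) (N : nat) : set 'rV[R]_N :=
  [set x | dotp x x = 1].

(* C^k and C^oo on an open set U *)
Fixpoint Ck (R : realType) (V W : normedModType R) (k : nat) (U : set V)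
    (f : V -> W) : Prop :=
  match k with
  | 0 => forall x, U x -> {for x, continuous f}
  | k'.+1 => (forall x, U x -> differentiable f x) /\
             (forall v : V, Ck k' U (fun x => 'D_v f x))
  end.

Definition smooth (R : realType) (V W : normedModType R) (U : set V)
    (f : V -> W) : Prop := forall k, Ck k U f.

(* Functions and fields on a subset M of R^N are represented by functions on
   R^N of which only the values on M matter; smoothness on M means that, near
   each point of M, the restriction to M extends smoothly. *)
Definition smooth_on (R : realType) (V W : normedModType R) (M : set V)
    (u : V -> W) : Prop :=
  forall x, M x -> exists (U : set V) (g : V -> W),
    [/\ open U, U x, smooth U g & forall y, M y -> U y -> g y = u y].

(* Embedded d-dimensional submanifold of R^N: locally the zero set of a smooth
   submersion into R^(N - d).  It is required to be nonempty, so that d is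
   determined by M. *)
Definition submanifold (R : realType) (N d : nat) (M : set 'rV[R]_N) : Prop :=
  [/\ (d <= N)%N, M !=set0 &
    forall x, M x -> exists (U : set 'rV[R]_N) (g : 'rV[R]_N -> 'rV[R]_(N - d)),
      [/\ open U, U x, smooth U g,
          forall y, U y -> (M y <-> g y = 0) &
          forall y, U y -> M y -> forall w, exists v, 'D_v g y = w]].

Section SubmanifoldCalculus.
Variables (R : realType) (N : nat).
Implicit Types (M : set 'rV[R]_N) (u : 'rV[R]_N -> R) (X : 'rV[R]_N -> 'rV[R]_N).
Implicit Types (x v w : 'rV[R]_N).

Definition curve M x v (c : R -> 'rV[R]_N) : Prop :=
  [/\ c 0 = x, \forall t \near 0, M (c t) & is_derive (0 : R) (1 : R) c v].

Definition tangent M x : set 'rV[R]_N := [set v | exists c, curve M x v c].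

(* Differential at x, along the tangent vector v, of a function on M; for a
   vector field it is the derivative in the flat ambient space. *)
Definition mdiff (W : normedModType R) M (u : 'rV[R]_N -> W) x v : W :=
  xget 0 [set w | exists2 c, curve M x v c & is_derive (0 : R) (1 : R) (u \o c) w].

Definition grad M u x : 'rV[R]_N :=
  xget 0 [set g | tangent M x g /\
                  forall v, tangent M x v -> dotp g v = mdiff M u x v].

Definition orthonormal_basis (T : set 'rV[R]_N) (d : nat)
    (e : 'I_d -> 'rV[R]_N) : Prop :=
  [/\ forall i, T (e i),
      forall i j, dotp (e i) (e j) = (i == j)%:R &
      forall v, T v -> v = \sum_(i < d) dotp v (e i) *: e i].

(* The Levi-Civita connection of the induced metric is the tangential part of
   the ambient derivative, whence div X = sum_i <D_(e_i) X, e_i> and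
   Hess u (v, w) = <D_v (grad u), w>. *)
Definition divergence M X x : R :=
  xget 0 [set s | exists d (e : 'I_d -> 'rV[R]_N),
    orthonormal_basis (tangent M x) e /\
    s = \sum_(i < d) dotp (mdiff M X x (e i)) (e i)].

Definition laplacian M u x : R := divergence M (grad M u) x.

Definition hessian M u x v w : R := dotp (mdiff M (grad M u) x v) w.

Definition critical_set M u : set 'rV[R]_N := [set x | M x /\ grad M u x = 0].

Definition eigenfunction M (lam : R) u : Prop :=
  [/\ smooth_on M u, exists2 x, M x & u x != 0 &
      forall x, M x -> laplacian M u x + lam * u x = 0].

Definition morse M u : Prop :=
  smooth_on M u /\
  forall x, critical_set M u x -> forall v, tangent M x v ->
    (forall w, tangent M x w -> hessian M u x v w = 0) -> v = 0.

Definition isoparametric M u : Prop :=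
  [/\ smooth_on M u,
      exists x y, [/\ M x, M y & u x != u y] &
      exists a b : R -> R,
        [/\ continuous a, smooth setT b &
            forall x, M x -> dotp (grad M u x) (grad M u x) = b (u x) /\
                             laplacian M u x = a (u x)]].

Definition focal_max M u : set 'rV[R]_N :=
  [set x | M x /\ forall y, M y -> u y <= u x].

Definition focal_min M u : set 'rV[R]_N :=
  [set x | M x /\ forall y, M y -> u x <= u y].

(* xi is, over the open set U, a unit normal field of M in the unit sphere *)
Definition unit_normal_field M (U : set 'rV[R]_N) X : Prop :=
  smooth_on (M `&` U) X /\
  forall y, M y -> U y ->
    [/\ dotp (X y) (X y) = 1, dotp (X y) y = 0 &
        forall v, tangent M y v -> dotp (X y) v = 0].

(* Trace of the shape operator v |-> - (D_v xi)^tangential *)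
Definition mean_curvature M (xi : 'rV[R]_N -> 'rV[R]_N) x : R :=
  - divergence M xi x.

Definition minimal_hypersurface_of_sphere M : Prop :=
  [/\ M `<=` @unit_sphere R N, submanifold (N - 2) M &
      forall (U : set 'rV[R]_N) xi, open U -> unit_normal_field M U xi ->
        forall x, M x -> U x -> mean_curvature M xi x = 0].

End SubmanifoldCalculus.

Definition clifford_system (R : realType) (l m : nat)
    (P : 'I_m.+1 -> 'M[R]_(2 * l)) : Prop :=
  (forall i, (P i)^T = P i) /\
  (forall i j, P i *m P j + P j *m P i = (2 * (i == j)%:R)%:M).

(* Vectors are rows, so x *m P stands for P x (P is symmetric). *)
Definition FKM_polynomial (R : realType) (l m : nat)
    (P : 'I_m.+1 -> 'M[R]_(2 * l)) (x : 'rV[R]_(2 * l)) : R :=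
  dotp x x ^+ 2 - 2 * \sum_(i < m.+1) dotp (x *m P i) x ^+ 2.

Definition FKM_hypersurface (R : realType) (l m : nat)
    (P : 'I_m.+1 -> 'M[R]_(2 * l)) (c : R) : set 'rV[R]_(2 * l) :=
  [set x | unit_sphere x /\ FKM_polynomial P x = c].

(* Main.v *)
Require Import Defs.
From HB Require Import structures.
From mathcomp Require Import all_boot all_order all_algebra.
From mathcomp Require Import all_classical all_reals all_analysis.
From mathcomp Require Import ring lra zify.
Import Order.TTheory GRing.Theory Num.Theory.
Import numFieldNormedType.Exports.
Local Open Scope classical_set_scope.
Local Open Scope ring_scope.

Set Implicit Arguments.
Unset Strict Implicit.
Unset Printing Implicit Defensive.

(** Write p_a(x) = <P_a x, x>, |p|^2 for the sum of the p_a^2, and W(x) for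
    the sum of the p_a(x) P_a, so that W(x)^2 = |p(x)|^2.  On the unit sphere
    F = 1 - 2 |p|^2, hence M is the level |p|^2 = z with z = (1 - c0) / 2 in
    ]0, 1[, and nu(x) = r (W(x) x - z x), with r^2 z (1 - z) = 1, is a unit
    normal field of M given by a cubic polynomial.  Its Jacobian B(x) is
    symmetric; on T_x M it is minus the shape operator.  The Clifford
    relations give its tangential trace, 2 r (m - z (l - 1)), so M is minimal
    if and only if m = z (l - 1).

    The eigenfunctions are phi1 = <x, q>, phi2 = p_0 and phi3 = <nu, q>.  The
    first is the classical fact on coordinates of a minimal submanifold of the
    sphere.  The third is an eigenfunction because M is minimal and the square
    norm of its shape operator is the constant 3n.  All three Laplacians come
    from one formula: if u has ambient gradient g and Hessian H, its gradient
    on M is the tangential part of g and its Laplacian is the tangential trace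
    of H, minus n <g, x>, minus <g, nu> times the mean curvature, which
    vanishes (lemma [laplacian_FKM]).

    The square norm of the gradient of phi2 is 4 (1 - phi2^2 / z).  Therefore
    phi2 is isoparametric and its critical points are those with p_0^2 = z,
    that is, the points of the sphere with p_0 = +- sqrt z and p_a = 0 for
    a > 0.  The vectors x, P_0 x, ..., P_m x are independent there, which
    makes the focal sets submanifolds of codimension m + 2 in R^(2l).

    A point x is critical for phi1 if and only if q lies in the plane spanned
    by x and nu(x), the plane of the normal great circle at x.  The gradient of
    phi3 is the image under B of that of phi1, and B is invertible on T_x M,
    since 0 is not a principal curvature of M; so phi3 has the same critical
    points.  At such a point the Hessian of phi1 is
    - (<q, x> + <q, nu> B), and that of phi3 is its product with B.  Both are
    nonsingular as soon as q is not a focal point, that is |p(q)| is neither 0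
    nor |q|^2 (lemma [shape_nondegenerate]).  The choice q = 2 u + v, with unit
    vectors u and v in the eigenspaces of P_0 for 1 and -1 such that v is
    orthogonal to all P_a u, makes the normal great circle through q explicit:
    it consists of the X u + Y v with X^2 + Y^2 = 1, where
    p = (X^2 - Y^2, 0, ..., 0), and it meets M in the 8 points with
    X^2 - Y^2 = +- sqrt z. *)

(** * Differentiation and smoothness in normed spaces *)

Section DifferentialRules.
Variable R : realType.
Implicit Types V W : normedModType R.

Lemma scale_is_bilinear W :
  bilinear_for
    (GRing.Scale.Law.clone _ _ *:%R _) (GRing.Scale.Law.clone _ _ *:%R _)
    (@GRing.scale R W).
Proof.
split=> [u'|u] a x y /=; first by rewrite scalerDl scalerA.
by rewrite scalerDr !scalerA mulrC.
Qed.

HB.instance Definition _ W :=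
  bilinear_isBilinear.Build R R W W _ _ (@GRing.scale R W)
    (scale_is_bilinear W).

Lemma is_diff_cstf V W (c : W) (x : V) : is_diff x (fun=> c) (fun=> 0).
Proof. exact: is_diff_cst. Qed.

Lemma is_diff_addf V W (f g df dg : V -> W) (x : V) :
  is_diff x f df -> is_diff x g dg ->
  is_diff x (fun y => f y + g y) (fun v => df v + dg v).
Proof. by move=> ? ?; exact: is_diffD. Qed.

Lemma is_diff_oppf V W (f df : V -> W) (x : V) :
  is_diff x f df -> is_diff x (fun y => - f y) (fun v => - df v).
Proof. by move=> ?; exact: is_diffN. Qed.

Lemma is_diff_sumf V W n (f df : 'I_n -> V -> W) (x : V) :
  (forall i, is_diff x (f i) (df i)) ->
  is_diff x (fun y => \sum_i f i y) (fun v => \sum_i df i v).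
Proof.
elim: n f df => [|n IH] f df H.
  rewrite (_ : (fun y => _) = fun=> 0); last by apply/funext => y; rewrite big_ord0.
  rewrite [X in is_diff x _ X](_ : _ = fun=> 0); first exact: is_diff_cstf.
  by apply/funext => y; rewrite big_ord0.
under eq_fun do rewrite big_ord_recl.
rewrite [X in is_diff x _ X](_ : _ = fun v => df ord0 v + \sum_i df (lift ord0 i) v).
  by apply: is_diff_addf => //; exact: IH.
by apply/funext => y; rewrite big_ord_recl.
Qed.

(** Scalar multiplication is a continuous bilinear map, so its product rule is
    the differential of that map composed with the pair (k, f). *)
Lemma is_diff_scalef V W (k dk : V -> R) (f df : V -> W) (x : V) :
  is_diff x k dk -> is_diff x f df ->
  is_diff x (fun y => k y *: f y) (fun v => k x *: df v + dk v *: f x).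
Proof.
move=> Dk Df.
pose b : {bilinear R -> W -> W} := @GRing.scale R W.
have bc : continuous (fun p : R * W => b p.1 p.2) by exact: scale_continuous.
have Dp : is_diff (k x, f x) (fun p : R * W => b p.1 p.2)
    (fun q => b (k x) q.2 + b q.1 (f x)).
  by apply: DiffDef; [exact: differentiable_bilin | rewrite diff_bilin].
exact: (is_diff_comp (is_diff_pair Dk Df) Dp).
Qed.

Lemma is_diff_mulf V (f g df dg : V -> R) (x : V) :
  is_diff x f df -> is_diff x g dg ->
  is_diff x (fun y => f y * g y) (fun v => f x * dg v + df v * g x).
Proof. exact: (@is_diff_scalef V R). Qed.

Lemma is_diff_ext V W (f df df' : V -> W) (x : V) :
  is_diff x f df' -> df' =1 df -> is_diff x f df.
Proof. by move=> H /funext <-. Qed.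

Lemma is_diff_derive V W (f df : V -> W) (x v : V) :
  is_diff x f df -> 'D_v f x = df v.
Proof. by move=> H; rewrite deriveE ?diff_val//; exact: ex_diff. Qed.

Lemma is_diff_coord n (x : 'rV[R]_n) (i : 'I_n) :
  is_diff x (fun y : 'rV[R]_n => y 0 i) (fun v => v 0 i).
Proof.
have @f : {linear 'rV[R]_n -> R}.
  by exists (fun N : 'rV[R]_n => N 0 i); do 2![eexists]; do ?[constructor];
     rewrite ?mxE// => ? *; rewrite ?mxE//; move=> ?; rewrite !mxE.
have fc : continuous f by exact: coord_continuous.
rewrite (_ : (fun y : 'rV[R]_n => _) = f)//.
by apply: DiffDef; [exact: linear_differentiable | rewrite diff_lin].
Qed.

Lemma is_diff_mulmx n k (A : 'M[R]_(n, k)) (x : 'rV[R]_n) :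
  is_diff x (fun y : 'rV[R]_n => y *m A) (fun v => v *m A).
Proof.
under eq_fun do rewrite mulmx_sum_row.
apply: is_diff_ext.
  apply: is_diff_sumf => i; apply: is_diff_scalef; exact: is_diff_coord.
by move=> v; apply: eq_bigr => i _; rewrite scaler0 add0r.
Qed.

Lemma is_diff_compmx V n k (A : 'M[R]_(n, k)) (f df : V -> 'rV[R]_n) x :
  is_diff x f df -> is_diff x (fun y => f y *m A) (fun v => df v *m A).
Proof. by move=> Df; exact: (is_diff_comp Df (is_diff_mulmx A (f x))). Qed.

Lemma is_diff_dotp V n (f g df dg : V -> 'rV[R]_n) x :
  is_diff x f df -> is_diff x g dg ->
  is_diff x (fun y => dotp (f y) (g y))
    (fun v => dotp (f x) (dg v) + dotp (df v) (g x)).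
Proof.
move=> Df Dg; apply: is_diff_ext.
  apply: is_diff_sumf => i; apply: is_diff_mulf.
    exact: (is_diff_comp Df (is_diff_coord (f x) i)).
  exact: (is_diff_comp Dg (is_diff_coord (g x) i)).
by move=> v; rewrite big_split.
Qed.

End DifferentialRules.

Section Smoothness.
Variable R : realType.
Implicit Types V W : normedModType R.

Lemma Ck_le V W k (f : V -> W) : Ck k.+1 setT f -> Ck k setT f.
Proof.
elim: k f => [|k IH] f [df Df]; last by split=> // v; exact: IH (Df v).
by move=> x _; apply: differentiable_continuous; exact: df.
Qed.

Lemma eq_Ck V W k (f g : V -> W) : f =1 g -> Ck k setT g -> Ck k setT f.
Proof. by move=> /funext ->. Qed.

Lemma Ck_cst V W k (c : W) : Ck k setT (fun _ : V => c).
Proof.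
elim: k c => [|k IH] c; first by move=> x _; exact: cst_continuous.
split=> [x _|v]; first exact: differentiable_cst.
by apply: eq_Ck (IH 0) => x; exact: derive_cst.
Qed.

Lemma Ck_add V W k (f g : V -> W) :
  Ck k setT f -> Ck k setT g -> Ck k setT (fun y => f y + g y).
Proof.
elim: k f g => [|k IH] f g Hf Hg.
  by move=> x _; apply: continuousD; [exact: Hf | exact: Hg].
case: Hf Hg => df Df [dg Dg]; split=> [x _|v].
  by apply: differentiableD; [exact: df | exact: dg].
apply: eq_Ck (IH _ _ (Df v) (Dg v)) => x; apply: deriveD; apply: diff_derivable; [exact: df|exact: dg].
Qed.

Lemma Ck_scale V W k (a : V -> R) (f : V -> W) :
  Ck k setT a -> Ck k setT f -> Ck k setT (fun y => a y *: f y).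
Proof.
elim: k a f => [|k IH] a f Ha Hf.
  by move=> x _; apply: continuousZ; [exact: Ha | exact: Hf].
have [Ha' Hf'] := (Ck_le Ha, Ck_le Hf).
case: Ha Hf => da Da [df Df].
have D x := is_diff_scalef (differentiableP (da x I)) (differentiableP (df x I)).
split=> [x _|v]; first exact: (ex_diff (is_diff_def := D x)).
apply: (eq_Ck (g := fun x => a x *: 'D_v f x + 'D_v a x *: f x)) => [x|].
  by rewrite (is_diff_derive v (D x)) (deriveE _ (df x I)) (deriveE _ (da x I)).
by apply: Ck_add; apply: IH => //; [exact: Df | exact: Da].
Qed.

Lemma Ck_lin V W (U : normedModType R) (L : W -> U) k (f : V -> W) :
  (forall x, is_diff x L L) -> Ck k setT f -> Ck k setT (fun y => L (f y)).
Proof.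
move=> HL; elim: k f => [|k IH] f.
  move=> Hf x _; apply: (@continuous_comp _ _ _ f L); first exact: Hf.
  apply: differentiable_continuous; exact: (ex_diff (is_diff_def := HL _)).
move=> [df Df].
have D x := is_diff_comp (differentiableP (df x I)) (HL (f x)).
split=> [x _|v]; first exact: (ex_diff (is_diff_def := D x)).
by apply: eq_Ck (IH _ (Df v)) => x; rewrite (is_diff_derive v (D x)) /= (deriveE _ (df x I)).
Qed.

Lemma smooth_cst V W (c : W) : smooth setT (fun _ : V => c).
Proof. by move=> k; exact: Ck_cst. Qed.

Lemma smooth_add V W (f g : V -> W) :
  smooth setT f -> smooth setT g -> smooth setT (fun y => f y + g y).
Proof. by move=> Hf Hg k; exact: Ck_add. Qed.

Lemma smooth_scale V W (a : V -> R) (f : V -> W) :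
  smooth setT a -> smooth setT f -> smooth setT (fun y => a y *: f y).
Proof. by move=> Hf Hg k; exact: Ck_scale. Qed.

(** A real product is the scaling of the real line over itself. *)
Lemma smooth_mul V (f g : V -> R) :
  smooth setT f -> smooth setT g -> smooth setT (fun y => f y * g y).
Proof. exact: smooth_scale. Qed.

Lemma smooth_sub V W (f g : V -> W) :
  smooth setT f -> smooth setT g -> smooth setT (fun y => f y - g y).
Proof.
move=> Hf Hg; apply: smooth_add => //.
under eq_fun do rewrite -scaleN1r.
by apply: smooth_scale => //; exact: smooth_cst.
Qed.

Lemma smooth_sum V W n (f : 'I_n -> V -> W) :
  (forall i, smooth setT (f i)) -> smooth setT (fun y => \sum_i f i y).
Proof.
elim: n f => [|n IH] f H.
  by under eq_fun do rewrite big_ord0; exact: smooth_cst.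
by under eq_fun do rewrite big_ord_recl; apply: smooth_add => //; exact: IH.
Qed.

Lemma smooth_id V : smooth setT (fun y : V => y).
Proof.
case=> [|k]; first by move=> x _; exact: cvg_id.
split=> [x _|v]; first exact: (ex_diff (is_diff_def := is_diff_id x)).
by under eq_fun do rewrite derive_id; exact: Ck_cst.
Qed.

Lemma smooth_compmx V n k (A : 'M[R]_(n, k)) (f : V -> 'rV[R]_n) :
  smooth setT f -> smooth setT (fun y => f y *m A).
Proof.
move=> H j; apply: (Ck_lin (L := fun z => z *m A)); last exact: H.
by move=> x; exact: is_diff_mulmx.
Qed.

Lemma smooth_dotp V n (f g : V -> 'rV[R]_n) :
  smooth setT f -> smooth setT g -> smooth setT (fun y => dotp (f y) (g y)).
Proof.
move=> Hf Hg; apply: smooth_sum => i; apply: smooth_mul => k.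
  apply: (Ck_lin (L := fun z : 'rV[R]_n => z 0 i)); last exact: Hf.
  by move=> x; exact: is_diff_coord.
apply: (Ck_lin (L := fun z : 'rV[R]_n => z 0 i)); last exact: Hg.
by move=> x; exact: is_diff_coord.
Qed.

Lemma smooth_row V n (f : 'I_n -> V -> R) :
  (forall i, smooth setT (f i)) -> smooth setT (fun y => \row_i f i y).
Proof.
move=> H k.
apply: (eq_Ck (g := fun y => \sum_i f i y *: (delta_mx 0 i : 'rV[R]_n))) => [y|].
  by rewrite [LHS]row_sum_delta; apply: eq_bigr => i _; rewrite mxE.
by apply: smooth_sum => i; apply: smooth_scale; [exact: H | exact: smooth_cst].
Qed.

Lemma smooth_onT V W (S : set V) (f : V -> W) : smooth setT f -> smooth_on S f.
Proof. by move=> sf x _; exists setT, f; split=> //; exact: openT. Qed.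

End Smoothness.

(** * The Euclidean product, orthonormal frames, derivatives along curves *)

Section EuclideanProduct.
Variables (R : realType) (N : nat).
Implicit Types (u v w a b : 'rV[R]_N) (A J : 'M[R]_N).

Lemma dotpE u v : dotp u v = (u *m v^T) 0 0.
Proof. by rewrite mxE; apply: eq_bigr => i _; rewrite mxE. Qed.

Lemma dotp_mx u v : u *m v^T = (dotp u v)%:M.
Proof. by rewrite [LHS]mx11_scalar -dotpE. Qed.

Lemma dotpC u v : dotp u v = dotp v u.
Proof. by apply: eq_bigr => i _; rewrite mulrC. Qed.

Lemma dotpDl u v w : dotp (u + v) w = dotp u w + dotp v w.
Proof. by rewrite !dotpE mulmxDl mxE. Qed.

Lemma dotpDr u v w : dotp u (v + w) = dotp u v + dotp u w.
Proof. by rewrite dotpC dotpDl !(dotpC u). Qed.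

Lemma dotpZl c u v : dotp (c *: u) v = c * dotp u v.
Proof. by rewrite !dotpE -scalemxAl mxE. Qed.

Lemma dotpZr c u v : dotp u (c *: v) = c * dotp u v.
Proof. by rewrite dotpC dotpZl dotpC. Qed.

Lemma dotpNl u v : dotp (- u) v = - dotp u v.
Proof. by rewrite -scaleN1r dotpZl mulN1r. Qed.

Lemma dotpNr u v : dotp u (- v) = - dotp u v.
Proof. by rewrite dotpC dotpNl dotpC. Qed.

Lemma dotp0l u : dotp 0 u = 0.
Proof. by rewrite dotpE mul0mx mxE. Qed.

Lemma dotp0r u : dotp u 0 = 0.
Proof. by rewrite dotpC dotp0l. Qed.

Lemma dotp_suml I (s : seq I) (F : I -> 'rV[R]_N) v :
  dotp (\sum_(i <- s) F i) v = \sum_(i <- s) dotp (F i) v.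
Proof. by elim/big_rec2: _ => [|i y z _ IH]; rewrite ?dotp0l// dotpDl IH. Qed.

Lemma dotp_sumr I (s : seq I) (F : I -> 'rV[R]_N) v :
  dotp v (\sum_(i <- s) F i) = \sum_(i <- s) dotp v (F i).
Proof. by rewrite dotpC dotp_suml; apply: eq_bigr => i _; rewrite dotpC. Qed.

Definition dotp_lin := (dotpDl, dotpDr, dotpNl, dotpNr, dotpZl, dotpZr).

Lemma dotp_mull u v A : dotp (u *m A) v = dotp u (v *m A^T).
Proof. by rewrite !dotpE trmx_mul trmxK mulmxA. Qed.

Lemma dotp_ge0 u : 0 <= dotp u u.
Proof. by apply: sumr_ge0 => i _; rewrite -expr2 sqr_ge0. Qed.

Lemma dotp_eq0 u : (dotp u u == 0) = (u == 0).
Proof.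
apply/eqP/eqP => [/eqP|->]; last exact: dotp0l.
rewrite psumr_eq0 => [/allP H|i _]; last by rewrite -expr2 sqr_ge0.
apply/rowP => i; rewrite mxE; apply/eqP.
by have := H i (mem_index_enum i); rewrite /= mulf_eq0 orbb.
Qed.

Lemma mul_outer v a b : v *m (a^T *m b) = dotp v a *: b.
Proof. by rewrite mulmxA dotp_mx mul_scalar_mx. Qed.

Lemma trace_outer a b : \tr (a^T *m b) = dotp a b.
Proof. by rewrite mxtrace_mulC dotp_mx mxtrace_scalar mulr1n dotpC. Qed.

Lemma ex_unit_vector u : u != 0 -> exists c : R, dotp (c *: u) (c *: u) = 1.
Proof.
rewrite -dotp_eq0 => u0; exists (Num.sqrt (dotp u u))^-1.
rewrite dotpZl dotpZr mulrA -invfM -expr2 sqr_sqrtr ?dotp_ge0//.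
by rewrite mulVf.
Qed.

End EuclideanProduct.

Section OrthonormalFrames.
Variables (R : realType) (N : nat).

(** As long as the rows of A do not span, a unit vector of the kernel of the
    transpose of A can be appended; the induction is on the codimension. The
    last identity says that the two row spaces together fill R^N: it is what
    turns traces over B into full traces minus the contribution of A. *)
Lemma orthonormal_completion k (A : 'M[R]_(k, N)) :
  A *m A^T = 1%:M ->
  exists d (B : 'M[R]_(d, N)),
    [/\ B *m B^T = 1%:M, A *m B^T = 0 & A^T *m A + B^T *m B = 1%:M].
Proof.
move Ej : (N - k)%N => j; elim: j k A Ej => [|j IH] k A Ej AA;
  have [kA|kA0] := eqVneq (kermx A^T) 0.
1,3: exists 0, 0; split; [by apply/matrixP => -[]|exact: thinmx0|];
  rewrite mulmx0 addr0; apply/eqP; rewrite -subr_eq0 -submx0 -kA;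
  by apply/sub_kermxP; rewrite mulmxBl mul1mx -mulmxA AA mulmx1 subrr.
all: case/rowV0Pn: kA0 => u /sub_kermxP uA u0; have [c cu] := ex_unit_vector u0.
all: set v := c *: u in cu; have vA : v *m A^T = 0 by rewrite -scalemxAl uA scaler0.
all: have CC : col_mx A v *m (col_mx A v)^T = 1%:M.
1,3: rewrite tr_col_mx mul_col_row AA vA dotp_mx cu -[A *m v^T]trmxK;
  by rewrite trmx_mul trmxK vA trmx0 -scalar_mx_block.
- have /eqP H : row_free (col_mx A v) by apply/row_freeP; exists (col_mx A v)^T.
  have := rank_leq_col (col_mx A v); rewrite H addn1 ltnNge -subn_eq0 Ej.
  by [].
- have [|d [B [BB CB CCB]]] := IH _ (col_mx A v) _ CC; first by rewrite addn1 subnS Ej.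
  have AB : A *m B^T = 0.
    by have := congr1 usubmx CB; rewrite mul_col_mx col_mxKu linear0.
  have vB : v *m B^T = 0.
    by have := congr1 dsubmx CB; rewrite mul_col_mx col_mxKd linear0.
  exists (1 + d)%N, (col_mx v B); split.
  + rewrite tr_col_mx mul_col_row BB dotp_mx cu vB -[B *m v^T]trmxK.
    by rewrite trmx_mul trmxK vB trmx0 -scalar_mx_block.
  + rewrite tr_col_mx mul_mx_row AB -[A *m v^T]trmxK trmx_mul trmxK vA trmx0.
    exact: row_mx0.
  + rewrite -CCB !tr_col_mx !mul_row_col addrA; congr (_ + _).
Qed.

End OrthonormalFrames.

Section MdiffChain.
Variables (R : realType) (N : nat) (W : normedModType R).

(** Only the values of u on M enter, because the curve stays in M for small
    times; this is why a field on M can be differentiated through any ambient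
    formula for it. *)
Lemma is_derive_curve (M : set 'rV[R]_N) x v c (u U dU : 'rV[R]_N -> W) :
  (forall y, M y -> u y = U y) -> is_diff x U dU -> curve M x v c ->
  is_derive (0 : R) (1 : R) (u \o c) (dU v).
Proof.
move=> uU DU [c0 Mc Dc].
have Dc' : differentiable c 0 by apply/derivable1_diffP; exact: (ex_derive (is_derive := Dc)).
have cd : is_diff (0 : R) c ('d c (0:R)) by exact: differentiableP.
rewrite -c0 in DU.
have DD := is_diff_comp cd DU.
have H : is_derive (0 : R) (1 : R) (U \o c) (dU v).
  apply: DeriveDef; first by apply: diff_derivable; exact: (ex_diff (is_diff_def := DD)).
  rewrite (is_diff_derive (1 : R) DD) /=; congr (dU _).
  by rewrite -deriveE//; exact: (derive_val (is_derive := Dc)).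
apply: (near_eq_is_derive (f := U \o c)) => //.
by near=> t => /=; apply/esym/uU; near: t.
Unshelve. all: by end_near. Qed.

Lemma mdiffE (M : set 'rV[R]_N) x v (u U dU : 'rV[R]_N -> W) :
  (forall y, M y -> u y = U y) -> is_diff x U dU -> tangent M x v ->
  mdiff M u x v = dU v.
Proof.
move=> uU DU [c Hc]; apply: xget_unique.
  by exists c => //; exact: is_derive_curve Hc.
move=> w [c' Hc' Dw]; have H := is_derive_curve uU DU Hc'.
by rewrite -(derive_val (is_derive := Dw)) (derive_val (is_derive := H)).
Qed.

End MdiffChain.

(** * Hypersurfaces of the unit sphere with a unit normal field *)

(** The normal field nu is differentiable on the whole space, not only along
    M, and its Jacobian B is symmetric: this holds when nu is the gradient of
    a polynomial, and makes gradients and Hessians on M computable from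
    ambient formulas. *)
Record sphere_hypersurface (R : realType) (N : nat) (M : set 'rV[R]_N)
    (nu : 'rV[R]_N -> 'rV[R]_N) (B : 'rV[R]_N -> 'M[R]_N) : Prop := {
  sh_unit : forall x, M x -> dotp x x = 1;
  sh_orth : forall x, M x -> dotp x (nu x) = 0;
  sh_nunit : forall x, M x -> dotp (nu x) (nu x) = 1;
  sh_tangent : forall x v, M x ->
    (tangent M x v <-> dotp v x = 0 /\ dotp v (nu x) = 0);
  sh_diff : forall x, is_diff x nu (fun v => v *m B x);
  sh_sym : forall x, (B x)^T = B x }.

Section SphereHypersurface.
Variables (R : realType) (N : nat) (M : set 'rV[R]_N).
Variables (nu : 'rV[R]_N -> 'rV[R]_N) (B : 'rV[R]_N -> 'M[R]_N).
Hypothesis MH : sphere_hypersurface M nu B.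
Implicit Types (x y v w g : 'rV[R]_N) (J H : 'M[R]_N).

(** Orthogonal projection to the tangent space at x. *)
Definition tproj x g := g - dotp g x *: x - dotp g (nu x) *: nu x.

(** Trace of the compression of J to the tangent space, written as the full
    trace minus the contributions of the two normal directions. *)
Definition ttrace x J := \tr J - dotp (x *m J) x - dotp (nu x *m J) (nu x).

Lemma dotp_sym_mx x u v : dotp (u *m B x) v = dotp u (v *m B x).
Proof. by rewrite dotp_mull (sh_sym MH). Qed.

Lemma tangent_tproj x g : M x -> tangent M x (tproj x g).
Proof.
move=> Mx; apply/(sh_tangent MH _ Mx); rewrite !dotp_lin (dotpC (nu x) x).
rewrite (sh_unit MH Mx) (sh_orth MH Mx) (sh_nunit MH Mx); split; ring.
Qed.

Lemma tangentB x v w : M x -> tangent M x v -> tangent M x w -> tangent M x (v - w).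
Proof.
move=> Mx /(sh_tangent MH _ Mx)[v1 v2] /(sh_tangent MH _ Mx)[w1 w2].
by apply/(sh_tangent MH _ Mx); rewrite !dotp_lin v1 v2 w1 w2 subrr.
Qed.

Lemma tangentD_scale x a b v w : M x -> tangent M x v -> tangent M x w ->
  tangent M x (a *: v + b *: w).
Proof.
move=> Mx /(sh_tangent MH _ Mx)[v1 v2] /(sh_tangent MH _ Mx)[w1 w2].
by apply/(sh_tangent MH _ Mx); rewrite !dotp_lin v1 v2 w1 w2 !mulr0 addr0.
Qed.

Lemma tangent_eq0 x v : M x -> tangent M x v ->
  (forall w, tangent M x w -> dotp v w = 0) -> v = 0.
Proof. by move=> Mx Tv H; apply/eqP; rewrite -dotp_eq0 H. Qed.

(** Differentiate the constants <x, nu> = 0 and <nu, nu> = 1 along M. *)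
Lemma tangent_mulB x v : M x -> tangent M x v -> tangent M x (v *m B x).
Proof.
move=> Mx Tv; have [vx vn] := (sh_tangent MH _ Mx).1 Tv.
apply/(sh_tangent MH _ Mx); split.
  have D := is_diff_dotp (is_diff_id x) (sh_diff MH x).
  have D0 := is_diff_cstf (0 : R) x.
  have := mdiffE (u := fun=> 0 : R) (fun y My => esym (sh_orth MH My)) D Tv.
  by rewrite (mdiffE (fun y _ => erefl) D0 Tv) vn addr0 dotpC => <-.
have D := is_diff_dotp (sh_diff MH x) (sh_diff MH x).
have D0 := is_diff_cstf (1 : R) x.
have := mdiffE (u := fun=> 1 : R) (fun y My => esym (sh_nunit MH My)) D Tv.
rewrite (mdiffE (fun y _ => erefl) D0 Tv) dotpC => /esym/eqP.
by rewrite -mulr2n mulrn_eq0 => /eqP.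
Qed.

Lemma dotp_tproj x g w : M x -> tangent M x w -> dotp (tproj x g) w = dotp g w.
Proof.
move=> Mx /(sh_tangent MH _ Mx)[wx wn]; rewrite /tproj !dotp_lin.
by rewrite (dotpC x) (dotpC (nu x)) wx wn !mulr0 !subr0.
Qed.

(** The pairing is nondegenerate on the tangent space, so the condition
    defining the gradient determines it. *)
Lemma gradE u x g : M x -> tangent M x g ->
  (forall v, tangent M x v -> mdiff M u x v = dotp g v) -> grad M u x = g.
Proof.
move=> Mx Tg Hg; apply: xget_unique; first by split=> // v /Hg.
move=> h [Th Hh]; apply/subr0_eq; apply: (tangent_eq0 Mx); first exact: tangentB.
by move=> w Tw; rewrite dotp_lin dotpNl Hh// Hg// subrr.
Qed.

Lemma grad_tproj u x g : M x -> is_diff x u (fun v => dotp g v) ->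
  grad M u x = tproj x g.
Proof.
move=> Mx Du; apply: (gradE Mx); first exact: tangent_tproj.
by move=> v Tv; rewrite (mdiffE (fun y _ => erefl) Du Tv) dotp_tproj.
Qed.

(** For a tangent orthonormal basis (e_i), the sum of the outer products e_i
    e_i^T is the projection to the tangent space, hence the trace over the
    basis does not depend on the basis. *)
Lemma frame_trace x J d (e : 'I_d -> 'rV[R]_N) : M x ->
  orthonormal_basis (tangent M x) e ->
  \sum_(i < d) dotp (e i *m J) (e i) = ttrace x J.
Proof.
move=> Mx [eT eo eb].
have sumE : \sum_i (e i)^T *m e i = 1%:M - x^T *m x - (nu x)^T *m nu x.
  apply/row_matrixP => k; rewrite !rowE mulmx_sumr !mulmxBr !mul_outer mulmx1.
  rewrite -/(tproj x (delta_mx 0 k)) (eb _ (tangent_tproj _ Mx)).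
  apply: eq_bigr => i _; rewrite mul_outer /tproj !dotp_lin.
  have [ex en] := (sh_tangent MH _ Mx).1 (eT i).
  by rewrite (dotpC x) (dotpC (nu x)) ex en !mulr0 !subr0.
transitivity (\tr ((\sum_i (e i)^T *m e i) *m J)).
  rewrite mulmx_suml linear_sum; apply: eq_bigr => i _.
  by rewrite /= -mulmxA trace_outer dotpC.
by rewrite sumE !mulmxBl mul1mx !linearB /= -!mulmxA !trace_outer /ttrace !(dotpC (_ *m J)).
Qed.

Lemma ex_orthonormal_basis x : M x ->
  exists d (e : 'I_d -> 'rV[R]_N), orthonormal_basis (tangent M x) e.
Proof.
move=> Mx.
have AA : col_mx x (nu x) *m (col_mx x (nu x))^T = 1%:M :> 'M[R]_(1 + 1).
  rewrite tr_col_mx mul_col_row !dotp_mx (dotpC (nu x) x).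
  rewrite (sh_unit MH Mx) (sh_orth MH Mx) (sh_nunit MH Mx).
  by rewrite !raddf0 -scalar_mx_block.
have [d [C [CC AC AAC]]] := orthonormal_completion AA.
exists d, (fun i => row i C); split.
- move=> i; apply/(sh_tangent MH _ Mx).
  have H : row i C *m (col_mx x (nu x))^T = 0.
    by rewrite -row_mul -[C *m _]trmxK trmx_mul trmxK AC trmx0 row0.
  move: H; rewrite tr_col_mx mul_mx_row !dotp_mx => H; split.
    have := congr1 lsubmx H; rewrite row_mxKl linear0 => /(congr1 (fun A : 'M[R]_1 => A 0 0)).
    by rewrite !mxE mulr1n.
  have := congr1 rsubmx H; rewrite row_mxKr linear0 => /(congr1 (fun A : 'M[R]_1 => A 0 0)).
  by rewrite !mxE mulr1n.
- move=> i j; transitivity ((C *m C^T) i j); last by rewrite CC !mxE.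
  by rewrite !mxE; apply: eq_bigr => k _; rewrite !mxE.
- move=> v /(sh_tangent MH _ Mx)[vx vn].
  rewrite -[LHS]mulmx1 -AAC mulmxDr tr_col_mx mul_row_col mulmxDr !mul_outer.
  rewrite vx vn !scale0r !add0r mulmxA mulmx_sum_row.
  by apply: eq_bigr => i _; congr (_ *: _); rewrite mxE; apply: eq_bigr => k _; rewrite !mxE.
Qed.

(** The field may be replaced by any ambient extension X', whose Jacobian
    yields the divergence as a tangential trace. *)
Lemma divergenceE (X X' : 'rV[R]_N -> 'rV[R]_N) J x : M x ->
  (forall y, M y -> X y = X' y) -> is_diff x X' (fun v => v *m J) ->
  divergence M X x = ttrace x J.
Proof.
move=> Mx XX' DX.
have val d (e : 'I_d -> 'rV[R]_N) : orthonormal_basis (tangent M x) e ->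
    \sum_(i < d) dotp (mdiff M X x (e i)) (e i) = ttrace x J.
  move=> eb; rewrite -(frame_trace _ Mx eb); apply: eq_bigr => i _.
  by case: eb => eT _ _; rewrite (mdiffE XX' DX (eT i)).
apply: xget_unique.
  by have [d [e eb]] := ex_orthonormal_basis Mx; exists d, e; rewrite val.
by move=> s [d [e [eb ->]]]; exact: val.
Qed.

Lemma is_diff_tproj (g : 'rV[R]_N -> 'rV[R]_N) H x :
  is_diff x g (fun v => v *m H) ->
  is_diff x (fun y => tproj y (g y)) (fun v => v *m
    (H - (g x + x *m H^T)^T *m x - (dotp (g x) x)%:M
       - (g x *m B x + nu x *m H^T)^T *m nu x - dotp (g x) (nu x) *: B x)).
Proof.
move=> Dg; have Did := is_diff_id x; have Dnu := sh_diff MH x.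
have Dx := is_diff_oppf (is_diff_scalef (is_diff_dotp Dg Did) Did).
have Dn := is_diff_oppf (is_diff_scalef (is_diff_dotp Dg Dnu) Dnu).
apply: is_diff_ext (is_diff_addf (is_diff_addf Dg Dx) Dn) _.
move=> v /=; rewrite !mulmxBr !mul_outer mul_mx_scalar -scalemxAr !dotp_lin.
rewrite -!dotp_mull -dotp_sym_mx (dotpC (g x) v) (dotpC (g x) (v *m B x)).
by rewrite !opprD !addrA [LHS]addrAC; congr (_ - _ - _); rewrite addrAC.
Qed.

(** Outer products with x or nu(x) on the right have no tangential trace. *)
Lemma ttrace_tproj (g : 'rV[R]_N -> 'rV[R]_N) H x : M x ->
  ttrace x (H - (g x + x *m H^T)^T *m x - (dotp (g x) x)%:M
       - (g x *m B x + nu x *m H^T)^T *m nu x - dotp (g x) (nu x) *: B x)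
  = ttrace x H - (N%:R - 2) * dotp (g x) x - dotp (g x) (nu x) * ttrace x (B x).
Proof.
move=> Mx; rewrite /ttrace !mulmxBr !mul_outer !mul_mx_scalar !dotp_lin !linearB /=.
rewrite !trace_outer mxtrace_scalar linearZ /= -!scalemxAr !dotp_lin.
rewrite (dotpC (nu x) x) (sh_unit MH Mx) (sh_orth MH Mx) (sh_nunit MH Mx) -mulr_natr.
rewrite !(dotpC _ x) !(dotpC _ (nu x)); ring.
Qed.

(** The Laplacian of a restriction: the tangential trace of the ambient
    Hessian, plus the product of g with the mean curvature vector in R^N,
    which is - (N - 2) x - tr(B) nu(x). *)
Lemma laplacianE (u : 'rV[R]_N -> R) (g : 'rV[R]_N -> 'rV[R]_N) H x : M x ->
  (forall y, is_diff y u (fun v => dotp (g y) v)) ->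
  is_diff x g (fun v => v *m H) ->
  laplacian M u x =
    ttrace x H - (N%:R - 2) * dotp (g x) x - dotp (g x) (nu x) * ttrace x (B x).
Proof.
move=> Mx Du Dg; rewrite -ttrace_tproj//; apply: divergenceE Mx _ (is_diff_tproj Dg).
by move=> y My; exact: grad_tproj.
Qed.

Lemma mean_curvatureE x : M x -> mean_curvature M nu x = - ttrace x (B x).
Proof. by move=> Mx; congr (- _); apply: divergenceE Mx _ (sh_diff MH x). Qed.

(** The Hessian of the height function in direction q: the position vector
    contributes the identity, the normal field contributes B. *)
Lemma is_diff_tproj_cst q x w : M x -> tangent M x w ->
  exists2 J, is_diff x (fun y => tproj y q) (fun v => v *m J) &
  forall w', tangent M x w' ->
    dotp (w *m J) w' = - dotp (dotp q x *: w + dotp q (nu x) *: (w *m B x)) w'.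
Proof.
move=> Mx Tw.
have D : is_diff x (fun=> q) (fun v => v *m 0).
  by apply: is_diff_ext (is_diff_cstf q x) _ => v; rewrite mulmx0.
eexists; first exact: (is_diff_tproj D).
move=> w' /(sh_tangent MH _ Mx)[w'x w'n].
rewrite !mulmxBr mulmx0 !mul_outer mul_mx_scalar -scalemxAr !dotp_lin.
by rewrite dotp0l (dotpC x) (dotpC (nu x)) w'x w'n; ring.
Qed.

End SphereHypersurface.

(** * Clifford systems *)

Lemma half_scalar_mx (R : realType) n (A : 'M[R]_n) c :
  A + A = (2 * c)%:M -> A = c%:M.
Proof.
move=> /matrixP E; apply/matrixP => i j; have := E i j; rewrite !mxE.
by case: (i == j); rewrite ?mulr1n ?mulr0n; lra.
Qed.

Section CliffordAlgebra.
Variables (R : realType) (l m : nat) (P : 'I_m.+1 -> 'M[R]_(2 * l)).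
Hypothesis HP : clifford_system P.
Implicit Types (x y u v : 'rV[R]_(2 * l)) (c d : 'I_m.+1 -> R).

Definition pform x (a : 'I_m.+1) : R := dotp (x *m P a) x.

Definition cliff c : 'M[R]_(2 * l) := \sum_a c a *: P a.

Definition psqnorm x : R := \sum_a pform x a ^+ 2.

Definition Wop x := cliff (pform x).

Lemma cliff_sqr_gen a : P a *m P a = 1%:M.
Proof. by apply: half_scalar_mx; rewrite HP.2 eqxx. Qed.

Lemma cliff_tr c : (cliff c)^T = cliff c.
Proof.
by rewrite /cliff linear_sum; apply: eq_bigr => a _; rewrite linearZ /= HP.1.
Qed.

Lemma cliff_gen c b : P b *m cliff c = (2 * c b)%:M - cliff c *m P b.
Proof.
apply/eqP; rewrite -subr_eq opprK; apply/eqP.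
rewrite mulmx_sumr mulmx_suml -big_split /= (bigD1 b)//= big1 => [|a ab].
  rewrite -scalemxAr -scalemxAl -scalerDr HP.2 eqxx mulr1 scale_scalar_mx addr0.
  by rewrite mulrC.
rewrite -scalemxAr -scalemxAl -scalerDr HP.2 eq_sym (negbTE ab) mulr0.
by rewrite raddf0 scaler0.
Qed.

(** The relations P_a P_b + P_b P_a = 2 delta_ab extend by bilinearity to all
    linear combinations. Used as a rewriting rule that exchanges two factors.
    *)
Lemma cliff_mul c d :
  cliff c *m cliff d = (2 * \sum_a c a * d a)%:M - cliff d *m cliff c.
Proof.
rewrite {1}/cliff mulmx_suml.
under eq_bigr do rewrite -scalemxAl cliff_gen scalerBr scale_scalar_mx.
rewrite big_split /= sumrN; congr (_ - _).
  rewrite -raddf_sum mulr_sumr; congr (_%:M).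
  by apply: eq_bigr => a _; rewrite mulrCA.
by rewrite /cliff mulmx_sumr; apply: eq_bigr => a _; rewrite scalemxAr.
Qed.

Lemma cliff_sqr c : cliff c *m cliff c = (\sum_a c a * c a)%:M.
Proof.
by apply: half_scalar_mx; rewrite {1}cliff_mul subrK.
Qed.

Lemma dotp_gen u v a : dotp (u *m P a) v = dotp u (v *m P a).
Proof. by rewrite dotp_mull HP.1. Qed.

Lemma dotp_cliff u v c : dotp (u *m cliff c) v = dotp u (v *m cliff c).
Proof. by rewrite dotp_mull cliff_tr. Qed.

Lemma mul_cliff u c : u *m cliff c = \sum_a c a *: (u *m P a).
Proof. by rewrite mulmx_sumr; apply: eq_bigr => a _; rewrite scalemxAr. Qed.

Lemma dotp_mul_cliff u v c : dotp (u *m cliff c) v = \sum_a c a * dotp (u *m P a) v.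
Proof. by rewrite mul_cliff dotp_suml; apply: eq_bigr => a _; rewrite dotpZl. Qed.

(** The mixed terms P_a P_b are antisymmetric for a <> b and so vanish on the
    diagonal. In particular the vectors P_a x are orthogonal, with the same
    norm as x. *)
Lemma dotp_gen_cliff x a c : dotp (x *m P a) (x *m cliff c) = c a * dotp x x.
Proof.
have E : dotp (x *m P a) (x *m cliff c) = dotp (x *m (P a *m cliff c)) x.
  by rewrite mulmxA dotp_cliff.
have : dotp (x *m P a) (x *m cliff c)
    = 2 * c a * dotp x x - dotp (x *m P a) (x *m cliff c).
  rewrite {1}E cliff_gen mulmxBr mul_mx_scalar !dotp_lin mulmxA; congr (_ - _).
  by rewrite dotp_gen dotpC.
lra.
Qed.

Lemma genE a : P a = cliff (fun b => (b == a)%:R).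
Proof.
rewrite /cliff (bigD1 a)//= eqxx scale1r big1 ?addr0// => b /negbTE ->.
by rewrite scale0r.
Qed.

Lemma dotp_gen_gen x a b : dotp (x *m P a) (x *m P b) = (a == b)%:R * dotp x x.
Proof. by rewrite (genE b) dotp_gen_cliff. Qed.

Lemma dotp_Wop x : dotp (x *m Wop x) x = psqnorm x.
Proof. by rewrite dotp_mul_cliff; apply: eq_bigr => a _; rewrite expr2. Qed.

Lemma Wop_sqr x : Wop x *m Wop x = (psqnorm x)%:M.
Proof. by rewrite cliff_sqr; congr (_%:M); apply: eq_bigr => a _; rewrite expr2. Qed.

Lemma dotp_Wop_Wop x : dotp (x *m Wop x) (x *m Wop x) = psqnorm x * dotp x x.
Proof. by rewrite dotp_cliff -mulmxA Wop_sqr mul_mx_scalar dotpZr. Qed.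

Lemma pform_Wop x a : pform (x *m Wop x) a = psqnorm x * pform x a.
Proof.
rewrite /pform -mulmxA dotpC dotp_cliff -2!mulmxA cliff_gen mulmxBr mul_mx_scalar.
rewrite mulmxA Wop_sqr mul_scalar_mx mulmxBr -!scalemxAr !dotp_lin.
by rewrite (dotpC x (x *m Wop x)) dotp_Wop (dotpC x) -/(pform x a); ring.
Qed.

(** Moving x along its normal great circle, spanned by x and W(x) x, only
    rescales the vector (p_a(x)). This is behind both the retraction onto M
    and the description of the critical points. *)
Lemma pform_comb x la mu a :
  pform (la *: x + mu *: (x *m Wop x)) a =
  (la ^+ 2 + 2 * la * mu * dotp x x + mu ^+ 2 * psqnorm x) * pform x a.
Proof.
rewrite {1}/pform mulmxDl -!scalemxAl !dotp_lin -/(pform x a).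
rewrite -/(pform (x *m Wop x) a) pform_Wop dotp_gen_cliff dotp_gen (dotpC (x *m Wop x)).
by rewrite dotp_gen_cliff; ring.
Qed.

Lemma dotp_comb x la mu :
  dotp (la *: x + mu *: (x *m Wop x)) (la *: x + mu *: (x *m Wop x)) =
  (la ^+ 2 + mu ^+ 2 * psqnorm x) * dotp x x + 2 * la * mu * psqnorm x.
Proof.
by rewrite !dotp_lin dotp_Wop_Wop (dotpC x (x *m _)) dotp_Wop; ring.
Qed.

Lemma Wop_conj_gen x a :
  Wop x *m P a *m Wop x = (2 * pform x a) *: Wop x - psqnorm x *: P a.
Proof.
by rewrite -mulmxA cliff_gen mulmxBr mul_mx_scalar mulmxA Wop_sqr mul_scalar_mx.
Qed.

(** Nonsingularity on the tangent space of la + mu B, where B is the Jacobian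
    of the normal field up to a factor and an additive constant. Pairing the
    equation with P_c x and with P_c W x gives two linear equations for b_c =
    <v, P_c x> and d_c = <v, P_c W x>, of determinant la^2 + 2 la mu + mu^2
    |p|^2; hence b = 0, and then (la + mu W) v = 0, where la + mu W is
    invertible because W^2 = |p|^2. *)
Lemma shape_nondegenerate x v la mu :
  dotp x x = 1 -> dotp v x = 0 -> dotp v (x *m Wop x) = 0 ->
  la ^+ 2 + 2 * la * mu + mu ^+ 2 * psqnorm x != 0 ->
  la ^+ 2 != mu ^+ 2 * psqnorm x ->
  la *: v + mu *: (2 *: \sum_a dotp v (x *m P a) *: (x *m P a) + v *m Wop x) = 0 ->
  v = 0.
Proof.
move=> x1 vx vW ne1 ne2 E.
pose b a := dotp v (x *m P a); pose d a := dotp v (x *m Wop x *m P a).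
have sumE : \sum_a dotp v (x *m P a) *: (x *m P a) = x *m cliff b.
  by rewrite mul_cliff.
have bp : \sum_a b a * pform x a = 0.
  rewrite -[RHS]vW mul_cliff dotp_sumr.
  by apply: eq_bigr => a _; rewrite dotpZr mulrC.
have H1 (c : 'I_m.+1) : (la + 2 * mu) * b c = mu * d c.
  have /(congr1 (fun w => dotp w (x *m P c))) := E.
  rewrite dotp0l !dotp_lin sumE (dotpC (x *m cliff b)) dotp_gen_cliff x1 -/(b c).
  rewrite dotp_cliff -mulmxA cliff_gen mulmxBr mul_mx_scalar mulmxA !dotp_lin -/(d c) vx.
  by move/eqP; rewrite -subr_eq0 subr0 => /eqP H; apply/subr0_eq; rewrite -H; ring.
have H2 (c : 'I_m.+1) : la * d c = - (mu * psqnorm x * b c).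
  have /(congr1 (fun w => dotp w (x *m Wop x *m P c))) := E.
  rewrite dotp0l !dotp_lin sumE -/(d c).
  have -> : dotp (v *m Wop x) (x *m Wop x *m P c) = - psqnorm x * b c.
    rewrite dotp_cliff -/(Wop x) -!(mulmxA x) Wop_conj_gen.
    rewrite mulmxBr -!scalemxAr !dotp_lin vW /b; ring.
  have -> : dotp (x *m cliff b) (x *m Wop x *m P c) = psqnorm x * b c.
    (* Y is exchanged with its opposite by moving W across cliff b. *)
    set Y := dotp _ _.
    have : Y = - Y + 2 * b c * psqnorm x.
      have WR : Wop x *m cliff b = - (cliff b *m Wop x).
        rewrite cliff_mul [X in 2 * X](_ : _ = 0) ?mulr0 ?raddf0 ?sub0r//.
        by rewrite -[RHS]bp; apply: eq_bigr => a _; rewrite mulrC.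
      have xR : dotp x (x *m cliff b) = 0.
        by rewrite dotpC dotp_mul_cliff; exact: bp.
      have EY : Y = 2 * b c * psqnorm x - dotp (x *m P c *m cliff b) (x *m Wop x).
        rewrite /Y -dotp_gen.
        have -> : x *m cliff b *m P c = (2 * b c) *: x - x *m P c *m cliff b.
          by rewrite -!mulmxA cliff_gen mulmxBr mul_mx_scalar opprB addrC subrK.
        by rewrite !dotp_lin (dotpC x) dotp_Wop.
      rewrite {1}EY dotp_cliff -[x *m Wop x *m _]mulmxA WR mulmxN dotpNr mulmxA -dotp_cliff.
      rewrite -[x *m P c *m _]mulmxA cliff_gen mulmxBr mul_mx_scalar !dotp_lin xR.
      by rewrite mulmxA (dotpC _ (x *m cliff b)) -/(Wop x) -/Y; ring.
    lra.
  by move=> H; apply/subr0_eq; rewrite -H; ring.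
have b0 (c : 'I_m.+1) : b c = 0.
  have : (la ^+ 2 + 2 * la * mu + mu ^+ 2 * psqnorm x) * b c = 0.
    have -> : (la ^+ 2 + 2 * la * mu + mu ^+ 2 * psqnorm x) * b c =
      la * ((la + 2 * mu) * b c) + mu ^+ 2 * psqnorm x * b c by ring.
    by rewrite H1 mulrCA H2; ring.
  by move/eqP; rewrite mulf_eq0 (negbTE ne1) => /eqP.
have E' : la *: v = - mu *: (v *m Wop x).
  move: E; rewrite big1 => [|a _]; last by rewrite -/(b a) b0 scale0r.
  by rewrite scaler0 add0r => /eqP; rewrite addr_eq0 scaleNr => /eqP.
have : (la ^+ 2 - mu ^+ 2 * psqnorm x) *: v = 0.
  rewrite scalerBl expr2 -scalerA E' scalerA (mulrC la) -scalerA scalemxAl E'.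
  rewrite -scalemxAl scalerA -mulmxA Wop_sqr mul_mx_scalar scalerA mulrNN -expr2.
  by rewrite subrr.
by move/eqP; rewrite scaler_eq0 subr_eq0 (negbTE ne2) => /eqP.
Qed.

End CliffordAlgebra.

Section CliffordFrame.
Variables (R : realType) (l m : nat) (P : 'I_m.+1 -> 'M[R]_(2 * l)).
Hypotheses (HP : clifford_system P) (m_gt0 : (0 < m)%N) (ml : (m + 1 < l)%N).

Let P0 := P ord0.
Let P1 := P ord_max.

Lemma P01_anticomm : P1 *m P0 = - (P0 *m P1).
Proof.
have := HP.2 ord0 ord_max; rewrite (_ : ord0 == ord_max = false); last first.
  by rewrite -val_eqE /= eq_sym; apply/negbTE; rewrite -lt0n.
by rewrite mulr0 raddf0 addrC => /eqP; rewrite addr_eq0 => /eqP.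
Qed.

Lemma eigenspace_plus_neq0 : 1%:M + P0 != 0.
Proof.
apply/eqP => /eqP; rewrite addrC addr_eq0 => /eqP E.
have := P01_anticomm; rewrite E mulmxN mulNmx mulmx1 mul1mx opprK => /eqP.
rewrite eq_sym -addr_eq0 => /eqP E1.
have P1_0 : P1 = 0%:M by apply: half_scalar_mx; rewrite E1 mulr0 raddf0.
have := cliff_sqr_gen HP ord_max; rewrite -/P1 P1_0 raddf0 mulmx0 => /matrixP E0.
have l0 : (0 < 2 * l)%N by rewrite muln_gt0 /=; exact: leq_trans ml.
have /eqP := E0 (Ordinal l0) (Ordinal l0); rewrite !mxE eqxx eq_sym mulr1n.
by rewrite oner_eq0.
Qed.

(** P_1 anticommutes with P_0 and therefore exchanges its two eigenspaces,
    which have the same dimension. *)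
Lemma rank_eigenspace : (\rank (1%:M + P0)%R <= l)%N.
Proof.
have E : P1 *m (1%:M + P0) *m P1 = 1%:M - P0.
  rewrite mulmxDr mulmx1 mulmxDl (cliff_sqr_gen HP) P01_anticomm mulNmx.
  by rewrite -mulmxA (cliff_sqr_gen HP) mulmx1.
have E' : P1 *m (1%:M - P0) *m P1 = 1%:M + P0.
  rewrite mulmxBr mulmx1 mulmxBl (cliff_sqr_gen HP) P01_anticomm mulNmx opprK.
  by rewrite -mulmxA (cliff_sqr_gen HP) mulmx1.
have rk : \rank (1%:M + P0)%R = \rank (1%:M - P0)%R.
  apply/eqP; rewrite eqn_leq; apply/andP; split; [rewrite -{1}E'|rewrite -{1}E];
    by apply: leq_trans (mxrankM_maxl _ _) (mxrankM_maxr _ _).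
have : (1%:M + P0) *m (1%:M - P0) = 0.
  rewrite mulmxDl mul1mx mulmxBr mulmx1 (cliff_sqr_gen HP).
  by rewrite addrA subrK subrr.
move/mulmx0_rank_max; rewrite -rk addnn -mul2n leq_pmul2l//.
Qed.

(** The conditions on v are at most l equations for the eigenspace and m + 1
    equations for the orthogonality; they have a nonzero solution since l + m
    + 1 < 2l. *)
Lemma ex_clifford_frame : exists u v : 'rV[R]_(2 * l),
  [/\ dotp u u = 1, dotp v v = 1, u *m P0 = u, v *m P0 = - v
    & forall a, dotp (u *m P a) v = 0].
Proof.
have [u [u1 uP]] : exists u : 'rV[R]_(2 * l), dotp u u = 1 /\ u *m P0 = u.
  have /rowV0Pn[w /submxP[D wE] w0] := eigenspace_plus_neq0.
  have [c wc] := ex_unit_vector w0; exists (c *: w); split=> //.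
  rewrite -scalemxAl wE -mulmxA mulmxDl mul1mx (cliff_sqr_gen HP).
  by rewrite [P0 + _]addrC.
pose C : 'M[R]_(m.+1, 2 * l) := \matrix_(a < m.+1) (u *m P a).
pose K := row_mx (1%:M + P0) C^T.
have : kermx K != 0.
  rewrite kermx_eq0 /row_free neq_ltn; apply/orP; left.
  rewrite -mxrank_tr tr_row_mx -addsmxE.
  apply: leq_ltn_trans (mxrank_adds_leqif _ _).1 _.
  rewrite trmxK mxrank_tr; apply: leq_ltn_trans (leq_add rank_eigenspace (rank_leq_row C)) _.
  by rewrite mul2n -addnn ltn_add2l -addn1.
case/rowV0Pn => w /sub_kermxP wK w0.
have [wP wC] : w *m (1%:M + P0) = 0 /\ w *m C^T = 0.
  move: wK; rewrite mul_mx_row => E; split.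
    by have := congr1 lsubmx E; rewrite row_mxKl linear0.
  by have := congr1 rsubmx E; rewrite row_mxKr linear0.
have [c wc] := ex_unit_vector w0; exists u, (c *: w); split=> //.
  move: wP; rewrite mulmxDr mulmx1 addrC => /eqP; rewrite addr_eq0 => /eqP E.
  by rewrite -scalemxAl E scalerN.
move=> a; rewrite dotpZr [X in c * X](_ : _ = 0) ?mulr0//.
have := congr1 (fun A : 'rV_ _ => A 0 a) wC; rewrite !mxE => <-.
by apply: eq_bigr => i _; rewrite !mxE mulrC; congr (_ * _); rewrite mxE.
Qed.

End CliffordFrame.

(** * Functions of one variable with vanishing derivative at the origin *)

Section FlatFunctions.
Variable R : realType.
Implicit Types k h : R -> R.

(** Derivative zero at the origin. The coefficients of the curve that realizes
    a tangent vector all have this property, which makes its velocity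
    explicit. *)
Definition flat k := is_derive (0 : R) (1 : R) k 0.

Lemma flat_cst c : flat (fun=> c).
Proof. exact: is_derive_cst. Qed.

Lemma flat_add k h : flat k -> flat h -> flat (fun t => k t + h t).
Proof. by move=> Dk Dh; rewrite /flat -[X in is_derive _ _ _ X](addr0 0); exact: is_deriveD Dk Dh. Qed.

Lemma flat_opp k : flat k -> flat (fun t => - k t).
Proof. by move=> Dk; rewrite /flat -[X in is_derive _ _ _ X]oppr0; exact: is_deriveN Dk. Qed.

Lemma flat_mul k h : flat k -> flat h -> flat (fun t => k t * h t).
Proof.
move=> Dk Dh; apply: is_derive_eq (is_deriveM Dk Dh) _.
by rewrite !scaler0 addr0.
Qed.

Lemma flat_inv k : k 0 != 0 -> flat k -> flat (fun t => (k t)^-1).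
Proof.
move=> k0 [dk k'0]; apply: DeriveDef; first exact: derivableV.
by rewrite deriveV// k'0 scaler0.
Qed.

Lemma flat_sqrt k : 0 < k 0 -> flat k -> flat (fun t => Num.sqrt (k t)).
Proof.
move=> k0 Dk; apply: is_derive_eq (is_derive1_comp (is_derive1_sqrt k0) Dk) _.
by rewrite mulr0.
Qed.

Lemma flat_near_gt0 k : flat k -> 0 < k 0 -> \forall t \near (0 : R), 0 < k t.
Proof.
move=> [/derivable1_diffP/differentiable_continuous kc _] k0.
exact: (kc _ (lt_nbhsr k0)).
Qed.

End FlatFunctions.

Section LineDerivatives.
Variables (R : realType) (V W : normedModType R).

Lemma is_diff_line (x v : V) :
  is_diff (0 : R) (fun t => x + t *: v) (fun t => t *: v).
Proof.
apply: is_diff_ext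
  (is_diff_addf (is_diff_cstf x (0 : R)) (is_diff_scalef (is_diff_id (0 : R)) (is_diff_cstf v (0 : R)))) _.
by move=> t /=; rewrite scaler0 !add0r.
Qed.

Lemma is_derive_line (f df : V -> W) (x v : V) :
  is_diff x f df -> is_derive (0 : R) (1 : R) (fun t => f (x + t *: v)) (df v).
Proof.
move=> Df; have Dl := is_diff_line x v.
have Df' : is_diff (x + 0 *: v) f df by rewrite scale0r addr0.
have D := is_diff_comp Dl Df'.
apply: DeriveDef; first by apply: diff_derivable; exact: (ex_diff (is_diff_def := D)).
by rewrite (is_diff_derive (1 : R) D) /= scale1r.
Qed.

Lemma is_derive_scale (a : R -> R) (f : R -> W) (a' : R) (f' : W) t :
  is_derive t (1 : R) a a' -> is_derive t (1 : R) f f' ->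
  is_derive t (1 : R) (fun s => a s *: f s) (a t *: f' + a' *: f t).
Proof.
move=> Da Df.
have da : differentiable a t by apply/derivable1_diffP; exact: ex_derive.
have df : differentiable f t by apply/derivable1_diffP; exact: ex_derive.
have D := is_diff_scalef (differentiableP da) (differentiableP df).
apply: DeriveDef; first by apply: diff_derivable; exact: (ex_diff (is_diff_def := D)).
by rewrite (is_diff_derive (1 : R) D) -!deriveE// !derive_val.
Qed.

End LineDerivatives.

(** * The level sets of the norm of (p_a): normal field and tangent spaces *)

Section FKMGeometry.
Variables (R : realType) (l m : nat) (P : 'I_m.+1 -> 'M[R]_(2 * l)).
Hypothesis HP : clifford_system P.
Implicit Types (x y u v q : 'rV[R]_(2 * l)).
Variable z : R.
Hypotheses (z_gt0 : 0 < z) (z_lt1 : z < 1).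

Definition psqnorm_level : set 'rV[R]_(2 * l) :=
  [set x | dotp x x = 1 /\ psqnorm P x = z].
Local Notation M := psqnorm_level.
Local Notation W := (Wop P).

(** The constant r for which r (W x - z x) is a unit vector on the level z. *)
Definition nscale : R := (Num.sqrt (z * (1 - z)))^-1.
Local Notation r := nscale.

Definition nfield y := r *: (y *m W y - z *: y).

(** Jacobian of the normal field. *)
Definition shape_mx y : 'M[R]_(2 * l) :=
  r *: (2 *: (\sum_a (y *m P a)^T *m (y *m P a)) + W y - z%:M).

Lemma z1_gt0 : 0 < z * (1 - z).
Proof. by rewrite mulr_gt0 ?subr_gt0. Qed.

Lemma nscale_sqr : r ^+ 2 * (z * (1 - z)) = 1.
Proof.
rewrite /nscale exprVn sqr_sqrtr ?(ltW z1_gt0)// mulVf//.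
by rewrite gt_eqF// z1_gt0.
Qed.

Lemma nscale_neq0 : r != 0.
Proof. by rewrite invr_neq0// gt_eqF// sqrtr_gt0 z1_gt0. Qed.

Lemma is_diff_pform x a :
  is_diff x (fun y => pform P y a) (fun v => 2 * dotp v (x *m P a)).
Proof.
apply: is_diff_ext (is_diff_dotp (is_diff_mulmx (P a) x) (is_diff_id x)) _ => v /=.
by rewrite (dotp_gen HP v) (dotpC _ v); ring.
Qed.

Lemma is_diff_Wop x : is_diff x (fun y => y *m W y) (fun v =>
  2 *: (\sum_a dotp v (x *m P a) *: (x *m P a)) + v *m W x).
Proof.
rewrite (_ : (fun y => _) = fun y => \sum_a pform P y a *: (y *m P a)); last first.
  by apply/funext => y; rewrite mul_cliff.
have D a := is_diff_scalef (is_diff_pform x a) (is_diff_mulmx (P a) x).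
apply: is_diff_ext (is_diff_sumf D) _ => v /=.
rewrite big_split /= addrC mul_cliff scaler_sumr; congr (_ + _).
by apply: eq_bigr => a _; rewrite scalerA.
Qed.

Lemma mul_shape v x : v *m shape_mx x =
  r *: (2 *: (\sum_a dotp v (x *m P a) *: (x *m P a)) + v *m W x - z *: v).
Proof.
rewrite /shape_mx -scalemxAr mulmxBr mulmxDr mul_mx_scalar -scalemxAr mulmx_sumr.
by congr (_ *: (_ *: _ + _ - _)); apply: eq_bigr => a _; rewrite mul_outer.
Qed.

Lemma is_diff_nfield x : is_diff x nfield (fun v => v *m shape_mx x).
Proof.
have D1 := is_diff_oppf (is_diff_scalef (is_diff_cstf z x) (is_diff_id x)).
have D := is_diff_scalef (is_diff_cstf r x) (is_diff_addf (is_diff_Wop x) D1).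
by apply: is_diff_ext D _ => v /=; rewrite mul_shape !scale0r !addr0.
Qed.

Lemma is_diff_psqnorm x : is_diff x (psqnorm P) (fun v => 4 * dotp v (x *m W x)).
Proof.
have D a := is_diff_mulf (is_diff_pform x a) (is_diff_pform x a).
rewrite (_ : psqnorm P = fun y => \sum_a pform P y a * pform P y a); last first.
  by apply/funext => y; apply: eq_bigr => a _; rewrite expr2.
apply: is_diff_ext (is_diff_sumf D) _ => v /=.
rewrite mul_cliff dotp_sumr mulr_sumr; apply: eq_bigr => a _.
by rewrite dotpZr; ring.
Qed.

Lemma psqnorm_comb x la mu :
  psqnorm P (la *: x + mu *: (x *m W x)) =
  (la ^+ 2 + 2 * la * mu * dotp x x + mu ^+ 2 * psqnorm P x) ^+ 2 * psqnorm P x.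
Proof.
by rewrite {1}/psqnorm mulr_sumr; apply: eq_bigr => a _; rewrite (pform_comb HP) exprMn.
Qed.

(** Differentiate |x|^2 = 1 and |p|^2 = z along M. *)
Lemma tangent_perp x v : M x -> tangent M x v ->
  dotp v x = 0 /\ dotp v (x *m W x) = 0.
Proof.
move=> Mx Tv; split.
  have D := is_diff_dotp (is_diff_id x) (is_diff_id x).
  have D0 := is_diff_cstf (1 : R) x.
  have := mdiffE (u := fun=> 1 : R) (fun y My => esym (proj1 My)) D Tv.
  rewrite (mdiffE (fun y _ => erefl) D0 Tv) dotpC => /esym/eqP.
  by rewrite -mulr2n mulrn_eq0 => /eqP.
have D0 := is_diff_cstf z x.
have := mdiffE (u := fun=> z) (fun y My => esym (proj2 My)) (is_diff_psqnorm x) Tv.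
rewrite (mdiffE (fun y _ => erefl) D0 Tv) => /esym/eqP.
by rewrite mulf_eq0 pnatr_eq0 /= => /eqP.
Qed.

(** A point y off the focal varieties is moved along its normal great circle
    to the level z. With Q = W(y) / sg, the components y + Q y and y - Q y
    have square norms 2 (|y|^2 + sg) and 2 (|y|^2 - sg); scaling them by A and
    B gives them the values that they have on the level z, where sg = s. *)
Lemma retract_mem y s sg A B :
  sg != 0 -> psqnorm P y = sg ^+ 2 -> s ^+ 2 = z ->
  A ^+ 2 * (dotp y y + sg) = 1 + s -> B ^+ 2 * (dotp y y - sg) = 1 - s ->
  M (((A + B) / 2) *: y + ((A - B) / (2 * sg)) *: (y *m W y)).
Proof.
move=> sg0 ysg sz HA HB.
have E : ((A - B) / (2 * sg)) * sg = (A - B) / 2 by field.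
set mu := (A - B) / (2 * sg) in E *.
split.
  rewrite (dotp_comb HP) ysg.
  have -> : (((A + B) / 2) ^+ 2 + mu ^+ 2 * sg ^+ 2) * dotp y y +
     2 * ((A + B) / 2) * mu * sg ^+ 2 =
     (((A + B) / 2) ^+ 2 + (mu * sg) ^+ 2) * dotp y y +
     2 * ((A + B) / 2) * (mu * sg) * sg by ring.
  transitivity ((A ^+ 2 * (dotp y y + sg) + B ^+ 2 * (dotp y y - sg)) / 2).
    by rewrite E; field.
  by rewrite HA HB; field.
rewrite psqnorm_comb ysg -sz.
have -> : s = (A ^+ 2 * (dotp y y + sg) - B ^+ 2 * (dotp y y - sg)) / 2.
  by rewrite HA HB; field.
rewrite -exprMn; congr (_ ^+ 2).
have -> : (((A + B) / 2) ^+ 2 + 2 * ((A + B) / 2) * mu * dotp y y +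
   mu ^+ 2 * sg ^+ 2) * sg =
   (((A + B) / 2) ^+ 2 + (mu * sg) ^+ 2) * sg +
   2 * ((A + B) / 2) * (mu * sg) * dotp y y by ring.
by rewrite E; field.
Qed.

(** Retract the line x + t v to M. Since |y|^2 and |p(y)|^2 are stationary at
    t = 0, so are the coefficients of the retraction, and the velocity of the
    resulting curve is v. *)
Lemma perp_tangent x v : M x ->
  dotp v x = 0 -> dotp v (x *m W x) = 0 -> tangent M x v.
Proof.
move=> [x1 xz] vx vW.
pose s := Num.sqrt z.
have s2 : s ^+ 2 = z by rewrite sqr_sqrtr// ltW.
have s_gt0 : 0 < s by rewrite sqrtr_gt0.
have s_lt1 : s < 1 by rewrite -sqrtr1 ltr_sqrt.
pose y (t : R) := x + t *: v.
have y0 : y 0 = x by rewrite /y scale0r addr0.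
pose Nt t := dotp (y t) (y t); pose Zt t := psqnorm P (y t).
pose sg t := Num.sqrt (Zt t).
(* A and B equal 1 at t = 0, so that the curve starts at x with velocity v. *)
pose A t := Num.sqrt ((1 + s) * (Nt t + sg t)^-1).
pose B t := Num.sqrt ((1 - s) * (Nt t - sg t)^-1).
have N0 : Nt 0 = 1 by rewrite /Nt y0.
have Z0 : Zt 0 = z by rewrite /Zt y0.
have sg0 : sg 0 = s by rewrite /sg Z0.
have fN : flat Nt.
  have D := is_diff_dotp (is_diff_id x) (is_diff_id x).
  apply: is_derive_eq (is_derive_line v D) _.
  by rewrite /= (dotpC x) vx addr0.
have fZ : flat Zt.
  by apply: is_derive_eq (is_derive_line v (is_diff_psqnorm x)) _; rewrite vW mulr0.
have fsg : flat sg by apply: flat_sqrt => //; rewrite Z0.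
have fNp : flat (fun t => Nt t + sg t) by exact: flat_add.
have fNm : flat (fun t => Nt t - sg t) by exact: flat_add fN (flat_opp fsg).
have s1p : 0 < 1 + s by rewrite addr_gt0.
have s1m : 0 < 1 - s by rewrite subr_gt0.
have A0 : A 0 = 1 by rewrite /A N0 sg0 divff ?sqrtr1// gt_eqF.
have B0 : B 0 = 1 by rewrite /B N0 sg0 divff ?sqrtr1// gt_eqF.
have fA : flat A.
  apply: flat_sqrt; first by rewrite N0 sg0 divr_gt0.
  by apply: flat_mul; [exact: flat_cst | apply: flat_inv => //; rewrite N0 sg0 gt_eqF].
have fB : flat B.
  apply: flat_sqrt; first by rewrite N0 sg0 divr_gt0.
  by apply: flat_mul; [exact: flat_cst | apply: flat_inv => //; rewrite N0 sg0 gt_eqF].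
have fla : flat (fun t => (A t + B t) / 2).
  by apply: flat_mul; [exact: flat_add | exact: flat_cst].
have fmu : flat (fun t => (A t - B t) / (2 * sg t)).
  apply: flat_mul; first exact: flat_add fA (flat_opp fB).
  apply: (@flat_inv _ (fun t => 2 * sg t)).
    by rewrite sg0 mulf_neq0 ?pnatr_eq0// gt_eqF.
  exact: flat_mul (flat_cst _) fsg.
have half2 : (1 + 1) / 2 = 1 :> R by field.
exists (fun t => ((A t + B t) / 2) *: y t + ((A t - B t) / (2 * sg t)) *: (y t *m W (y t))).
split.
- by rewrite A0 B0 subrr mul0r scale0r addr0 y0 half2 scale1r.
- near=> t.
  have Zt_gt0 : 0 < Zt t by near: t; apply: flat_near_gt0 fZ _; rewrite Z0.
  have Np : 0 < Nt t + sg t by near: t; apply: flat_near_gt0 fNp _; rewrite N0 sg0.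
  have Nm : 0 < Nt t - sg t by near: t; apply: flat_near_gt0 fNm _; rewrite N0 sg0.
  have sgt : sg t ^+ 2 = Zt t by rewrite sqr_sqrtr// ltW.
  apply: (@retract_mem _ s) => //.
  + by rewrite gt_eqF// sqrtr_gt0.
  + rewrite sqr_sqrtr ?divfK ?gt_eqF//.
    by rewrite ltW// divr_gt0.
  + rewrite sqr_sqrtr ?divfK ?gt_eqF//.
    by rewrite ltW// divr_gt0.
- have Dy : is_derive (0 : R) (1 : R) y v by exact: (is_derive_line v (is_diff_id x)).
  have Dw := is_derive_line v (is_diff_Wop x).
  have D := is_deriveD (is_derive_scale fla Dy) (is_derive_scale fmu Dw).
  apply: is_derive_eq D _.
  by rewrite A0 B0 subrr mul0r !scale0r !addr0 half2 scale1r.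
Unshelve. all: by end_near. Qed.

End FKMGeometry.

(** * Traces and Laplacians *)

Section FKMSpectrum.
Variables (R : realType) (l m : nat) (P : 'I_m.+1 -> 'M[R]_(2 * l)).
Hypothesis HP : clifford_system P.
Implicit Types (x y u v q : 'rV[R]_(2 * l)).
Variable z : R.
Hypotheses (z_gt0 : 0 < z) (z_lt1 : z < 1).
Local Notation M := (psqnorm_level P z).
Local Notation W := (Wop P).
Local Notation r := (nscale z).
Local Notation nu := (nfield P z).
Local Notation B := (shape_mx P z).

Lemma dotp_nfield x v : M x -> dotp v x = 0 ->
  dotp v (nu x) = r * dotp v (x *m W x).
Proof. by move=> Mx vx; rewrite /nfield !dotp_lin vx mulr0 subr0. Qed.

Lemma shape_sym x : (B x)^T = B x.
Proof.
rewrite /shape_mx linearZ /=; congr (_ *: _).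
rewrite linearB linearD /= linearZ /= linear_sum /=.
rewrite /Wop cliff_tr// tr_scalar_mx; congr (_ *: _ + _ - _).
by apply: eq_bigr => a _; rewrite trmx_mul trmxK.
Qed.

Lemma FKM_sphere_hypersurface : sphere_hypersurface M nu B.
Proof.
split.
- by move=> x [].
- move=> x [x1 xz]; rewrite /nfield !dotp_lin x1 (dotpC x) (dotp_Wop) xz; ring.
- move=> x [x1 xz]; rewrite /nfield !dotp_lin (dotpC x (_ *m _)) dotp_Wop.
  rewrite (dotp_Wop_Wop HP) x1 xz -[RHS](nscale_sqr z_gt0 z_lt1); ring.
- move=> x v Mx; split=> [Tv|[vx vn]].
    have [vx vW] := tangent_perp HP Mx Tv; split=> //.
    by rewrite dotp_nfield// vW mulr0.
  apply: (perp_tangent HP z_gt0 z_lt1 Mx vx).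
  apply/eqP; move/eqP: vn; rewrite dotp_nfield// mulf_eq0.
  by rewrite (negbTE (nscale_neq0 z_gt0 z_lt1)).
- by move=> x; exact: is_diff_nfield.
- exact: shape_sym.
Qed.

Local Notation MH := FKM_sphere_hypersurface.

Lemma nfieldE x : nu x = (- (r * z)) *: x + r *: (x *m W x).
Proof. by rewrite /nfield scalerBr scalerA addrC scaleNr. Qed.

Lemma mul_shape_x x : M x -> x *m B x = r *: (3 *: (x *m W x) - z *: x).
Proof.
move=> [x1 xz]; rewrite mul_shape; congr (_ *: (_ - _)).
rewrite (_ : \sum_a _ = x *m W x); last first.
  by rewrite mul_cliff; apply: eq_bigr => a _; rewrite dotpC.
by rewrite -[X in _ + X]scale1r -scalerDl; congr (_ *: _); ring.
Qed.

Lemma mul_shape_Wop x : M x ->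
  x *m W x *m B x = r *: ((2 - z) *: (x *m W x) + z *: x).
Proof.
move=> [x1 xz]; rewrite mul_shape; congr (_ *: _).
rewrite (_ : \sum_a _ = x *m W x); last first.
  rewrite [RHS]mul_cliff; apply: eq_bigr => a _.
  by rewrite dotpC (dotp_gen_cliff HP) x1 mulr1.
rewrite -mulmxA (Wop_sqr HP) mul_mx_scalar xz addrAC -scaleNr -scalerDl.
by [].
Qed.

(** The normal geodesic from x reaches nu(x) after a quarter turn; |p| is the
    sine of twice the distance to the focal variety p = 0, so p changes sign.
    *)
Lemma pform_nfield x a : M x -> pform P (nu x) a = - pform P x a.
Proof.
move=> [x1 xz]; rewrite nfieldE (pform_comb HP) x1 xz -[RHS]mulN1r.
by congr (_ * _); rewrite -[X in _ = - X](nscale_sqr z_gt0 z_lt1); ring.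
Qed.

Lemma ttrace_scalar x a J : ttrace nu x (a *: J) = a * ttrace nu x J.
Proof. by rewrite /ttrace linearZ /= -!scalemxAr !dotpZl; ring. Qed.

Hypothesis m_gt0 : (0 < m)%N.

(** P_a is conjugate to its opposite by any other P_b. *)
Lemma trace_gen a : \tr (P a) = 0.
Proof.
have [b ab] : exists b, b != a.
  have [->|] := eqVneq a ord0; last by rewrite eq_sym; exists ord0.
  by exists ord_max; rewrite -val_eqE /= -lt0n.
have E : P b *m P a *m P b = - P a.
  have := HP.2 b a; rewrite (negbTE ab) mulr0 raddf0 => /eqP.
  rewrite addr_eq0 => /eqP ->.
  by rewrite mulNmx -mulmxA (cliff_sqr_gen HP) mulmx1.
have := congr1 mxtrace E; rewrite mxtrace_mulC mulmxA (cliff_sqr_gen HP) mul1mx linearN /=.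
lra.
Qed.

Lemma trace_cliff c : \tr (cliff P c) = 0.
Proof.
rewrite /cliff linear_sum big1// => a _.
by rewrite linearZ /= trace_gen mulr0.
Qed.

(** The mean curvature, up to sign, is constant on each level and has a single
    zero among the levels. *)
Lemma ttrace_shape x : M x ->
  ttrace nu x (B x) = 2 * r * (m%:R - z * (l%:R - 1)).
Proof.
move=> Mx; have [x1 xz] := Mx.
have trB : \tr (B x) = r * (2 * (m%:R + 1) - 2 * l%:R * z).
  rewrite /shape_mx linearZ /=; congr (_ * _).
  rewrite linearB linearD /= linearZ /= linear_sum /=.
  rewrite trace_cliff mxtrace_scalar -[z *+ _]mulr_natr natrM addr0.
  under eq_bigr do rewrite trace_outer (dotp_gen_gen HP) eqxx x1 mulr1.
  by rewrite sumr_const card_ord -[_ *+ _]mulr_natr -[in m.+1%:R]addn1 natrD; ring.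
have xB : dotp (x *m B x) x = 2 * r * z.
  by rewrite mul_shape_x// !dotp_lin dotp_Wop x1 xz; ring.
have nB : dotp (nu x *m B x) (nu x) = r * (2 - 4 * z).
  rewrite nfieldE mulmxDl -!scalemxAl mul_shape_x// mul_shape_Wop// !dotp_lin.
  rewrite (dotpC x (x *m W x)) dotp_Wop (dotp_Wop_Wop HP) x1 xz.
  by rewrite -[RHS]mul1r -[X in _ = X * _](nscale_sqr z_gt0 z_lt1); ring.
by rewrite /ttrace trB xB nB; ring.
Qed.

Hypothesis level : m%:R = z * (l%:R - 1).

Lemma ttrace_shape0 x : M x -> ttrace nu x (B x) = 0.
Proof. by move=> Mx; rewrite ttrace_shape// level subrr mulr0. Qed.

(** On the minimal level the component of the gradient along nu does not
    contribute. *)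
Lemma laplacian_FKM (u : 'rV[R]_(2 * l) -> R) (g : 'rV[R]_(2 * l) -> 'rV[R]_(2 * l)) H x :
  M x -> (forall y, is_diff y u (fun v => dotp (g y) v)) ->
  is_diff x g (fun v => v *m H) ->
  laplacian M u x = ttrace nu x H - (2 * (l%:R - 1)) * dotp (g x) x.
Proof.
move=> Mx Du Dg; rewrite (laplacianE MH Mx Du Dg) ttrace_shape0// mulr0 subr0.
by rewrite natrM; congr (_ - _ * _); ring.
Qed.

Lemma is_diff_linear q x : is_diff x (fun y => dotp y q) (fun v => dotp q v).
Proof.
apply: is_diff_ext (is_diff_dotp (is_diff_id x) (is_diff_cstf q x)) _ => v /=.
by rewrite dotp0r add0r dotpC.
Qed.

Lemma laplacian_linear q x : M x ->
  laplacian M (fun y => dotp y q) x = - (2 * (l%:R - 1)) * dotp x q.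
Proof.
move=> Mx.
have D : is_diff x (fun=> q) (fun v => v *m 0).
  by apply: is_diff_ext (is_diff_cstf q x) _ => v; rewrite mulmx0.
rewrite (laplacian_FKM Mx (is_diff_linear q) D) /ttrace linear0 !mulmx0 !dotp0l.
by rewrite dotpC; ring.
Qed.

Lemma is_diff_pform_grad a x :
  is_diff x (pform P ^~ a) (fun v => dotp (2 *: (x *m P a)) v).
Proof.
by apply: is_diff_ext (is_diff_pform HP x a) _ => v; rewrite dotpZl dotpC.
Qed.

(** P_a has no trace and <P_a nu, nu> = - p_a, so the tangential trace of P_a
    vanishes as well. *)
Lemma laplacian_pform a x : M x ->
  laplacian M (pform P ^~ a) x = - (4 * (l%:R - 1)) * pform P x a.
Proof.
move=> Mx.
have D : is_diff x (fun y => 2 *: (y *m P a)) (fun v => v *m (2 *: P a)).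
  apply: is_diff_ext (is_diff_scalef (is_diff_cstf (2 : R) x) (is_diff_mulmx (P a) x)) _ => v.
  by rewrite scale0r addr0 scalemxAr.
rewrite (laplacian_FKM Mx (is_diff_pform_grad a) D) ttrace_scalar /ttrace trace_gen.
by rewrite -/(pform P (nu x) a) pform_nfield// dotpZl -/(pform P x a); ring.
Qed.

Lemma is_diff_normal q x :
  is_diff x (fun y => dotp (nu y) q) (fun v => dotp (q *m B x) v).
Proof.
have D := is_diff_dotp (is_diff_nfield HP z x) (is_diff_cstf q x).
apply: is_diff_ext D _ => v /=.
by rewrite dotp0r add0r (dotp_sym_mx MH) dotpC.
Qed.

(** Jacobian of the field B(x) q, which is the ambient gradient of <nu, q>. *)
Definition shape_deriv q x : 'M[R]_(2 * l) := (2 * r) *: \sum_a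
  ((q *m P a)^T *m (x *m P a) + dotp q (x *m P a) *: P a
   + (x *m P a)^T *m (q *m P a)).

Lemma mul_shape_deriv q x v : v *m shape_deriv q x = (2 * r) *: \sum_a
  (dotp v (q *m P a) *: (x *m P a) + dotp q (x *m P a) *: (v *m P a)
   + dotp v (x *m P a) *: (q *m P a)).
Proof.
rewrite -scalemxAr mulmx_sumr; congr (_ *: _); apply: eq_bigr => a _.
by rewrite !mulmxDr !mul_outer -scalemxAr.
Qed.

Lemma is_diff_shape q x : is_diff x (fun y => q *m B y) (fun v => v *m shape_deriv q x).
Proof.
have -> : (fun y => q *m B y) = fun y => r *: (2 *: (\sum_a dotp q (y *m P a) *: (y *m P a))
    + (\sum_a pform P y a *: (q *m P a)) - z *: q).
  by apply/funext => y; rewrite mul_shape [q *m Wop P y]mul_cliff.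
have Did := is_diff_id x.
have D1 a := is_diff_scalef
  (is_diff_dotp (is_diff_cstf q x) (is_diff_compmx (P a) Did)) (is_diff_compmx (P a) Did).
have D2 a := is_diff_scalef (is_diff_pform HP x a) (is_diff_cstf (q *m P a) x).
have D3 := is_diff_oppf (is_diff_cstf (z *: q) x).
have D := is_diff_scalef (is_diff_cstf r x) (is_diff_addf
  (is_diff_addf (is_diff_scalef (is_diff_cstf (2 : R) x) (is_diff_sumf D1))
    (is_diff_sumf D2)) D3).
apply: is_diff_ext D _ => v /=.
rewrite mul_shape_deriv !scale0r oppr0 !addr0 mulrC -scalerA; congr (_ *: _).
rewrite !scaler_sumr -big_split; apply: eq_bigr => a _ /=.
rewrite dotp0l addr0 scaler0 add0r -scalerA -!scalerDr.
rewrite (dotpC q (v *m _)) (dotp_gen HP v q).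
by congr (_ *: (_ + _)); rewrite addrC.
Qed.

Lemma dotp_mul_shape_deriv q x v : dotp (v *m shape_deriv q x) v =
  2 * r * \sum_a (2 * dotp v (x *m P a) * dotp v (q *m P a)
     + dotp q (x *m P a) * pform P v a).
Proof.
rewrite mul_shape_deriv dotpZl dotp_suml; congr (_ * _); apply: eq_bigr => a _.
by rewrite !dotp_lin !(dotpC (_ *m P a) v) -(dotpC (v *m P a)) -/(pform P v a); ring.
Qed.

(** The terms in <W x, q> cancel, which reflects the Codazzi equation; what is
    left depends on the component of q along x only. *)
Lemma ttrace_shape_deriv q x : M x ->
  ttrace nu x (shape_deriv q x) = 4 * m%:R * r * dotp x q.
Proof.
move=> Mx; have [x1 xz] := Mx.
have tr : \tr (shape_deriv q x) = 4 * (m%:R + 1) * r * dotp x q.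
  rewrite /shape_deriv linearZ /= linear_sum /=.
  under eq_bigr => a _.
    rewrite !linearD /= linearZ /= trace_gen mulr0 addr0 !trace_outer.
    rewrite !(dotp_gen HP) -!mulmxA (cliff_sqr_gen HP) !mulmx1 (dotpC q).
    over.
  by rewrite sumr_const card_ord -[_ *+ m.+1]mulr_natr -[in m.+1%:R]addn1 natrD; ring.
have sumW v : \sum_a pform P x a * dotp v (q *m P a) = dotp (v *m W x) q.
  by rewrite (dotp_mul_cliff) ; apply: eq_bigr => a _; rewrite (dotp_gen HP).
have X : dotp (x *m shape_deriv q x) x = 6 * r * dotp (x *m W x) q.
  rewrite dotp_mul_shape_deriv -sumW !mulr_sumr; apply: eq_bigr => a _.
  by rewrite (dotpC x (x *m _)) -/(pform P x a) (dotpC q) (dotp_gen HP); ring.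
have Y : dotp (nu x *m shape_deriv q x) (nu x) =
    r * (4 * dotp x q - 6 * dotp (x *m W x) q).
  have nP a : dotp (nu x) (x *m P a) = r * (1 - z) * pform P x a.
    rewrite nfieldE !dotp_lin (dotpC x) -/(pform P x a) (dotpC (x *m W x)).
    by rewrite (dotp_gen_cliff HP) x1; ring.
  have nW : dotp (nu x *m W x) q = r * z * (dotp x q - dotp (x *m W x) q).
    rewrite nfieldE mulmxDl -!scalemxAl -mulmxA (Wop_sqr HP) mul_mx_scalar xz.
    by rewrite !dotp_lin; ring.
  rewrite dotp_mul_shape_deriv.
  under eq_bigr => a _ do rewrite nP pform_nfield// (dotpC q) (dotp_gen HP).
  transitivity (2 * r * (2 * r * (1 - z) * dotp (nu x *m W x) q - dotp (x *m W x) q)).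
    congr (_ * _); rewrite -!sumW mulr_sumr -sumrN -big_split /=.
    by apply: eq_bigr => a _; ring.
  rewrite nW -[RHS]mul1r; have := nscale_sqr z_gt0 z_lt1.
  set c := dotp x q; set d := dotp _ q => E.
  have -> : 2 * r * (2 * r * (1 - z) * (r * z * (c - d)) - d) =
    2 * r * (2 * (r ^+ 2 * (z * (1 - z))) * (c - d) - d) by ring.
  by rewrite E; ring.
by rewrite /ttrace tr X Y; ring.
Qed.

Lemma laplacian_normal q x : M x ->
  laplacian M (fun y => dotp (nu y) q) x = - (6 * (l%:R - 1)) * dotp (nu x) q.
Proof.
move=> Mx; rewrite (laplacian_FKM Mx (is_diff_normal q) (is_diff_shape q x)).
rewrite ttrace_shape_deriv// (dotp_sym_mx MH) (dotpC q) mul_shape_x// nfieldE !dotp_lin level.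
ring.
Qed.

End FKMSpectrum.

(** * Critical points and Hessians of the height and normal functions *)

Lemma card_range_finType (T : finType) (U : Type) (f : T -> U) :
  injective f -> (range f #= `I_#|T|)%card.
Proof.
move=> injf; apply: card_eq_trans (inj_card_eq (in2W injf)) _.
apply: card_eq_trans; last by rewrite card_eq_sym; exact: card_II.
rewrite card_eq_sym (_ : [set: 'I_#|T|] = range (@enum_rank T)).
  by apply: inj_card_eq => a b _ _; exact: enum_rank_inj.
by apply/seteqP; split=> // i _; exists (enum_val i) => //; exact: enum_valK.
Qed.

Section FKMCritical.
Variables (R : realType) (l m : nat) (P : 'I_m.+1 -> 'M[R]_(2 * l)).
Hypothesis HP : clifford_system P.
Implicit Types (x y u v q w : 'rV[R]_(2 * l)).
Variable z : R.
Hypotheses (z_gt0 : 0 < z) (z_lt1 : z < 1).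
Local Notation M := (psqnorm_level P z).
Local Notation W := (Wop P).
Local Notation r := (nscale z).
Local Notation nu := (nfield P z).
Local Notation B := (shape_mx P z).
Let MH := FKM_sphere_hypersurface HP z_gt0 z_lt1.

Lemma tangent_iff x w : M x ->
  (tangent M x w <-> dotp w x = 0 /\ dotp w (x *m W x) = 0).
Proof.
move=> Mx; split; first exact: tangent_perp.
by case; exact: perp_tangent.
Qed.

(** The coefficients are those of q in the basis x, W(x) x of the normal
    plane. *)
Lemma tproj_eq0 x g : M x -> tproj nu x g = 0 ->
  exists la mu, [/\ g = la *: x + mu *: (x *m W x),
    la = dotp g x - dotp g (nu x) * r * z & mu = dotp g (nu x) * r].
Proof.
move=> Mx /eqP; rewrite /tproj -addrA -opprD subr_eq0 => /eqP E.
exists (dotp g x - dotp g (nu x) * r * z), (dotp g (nu x) * r); split=> //.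
rewrite {1}E nfieldE scalerDr !scalerA addrA -scalerDl.
by congr (_ *: _ + _); ring.
Qed.

Lemma normal_nondegenerate x w a b : M x -> tangent M x w ->
  let la := a - b * r * z in let mu := b * r in
  la ^+ 2 + 2 * la * mu + mu ^+ 2 * z != 0 -> la ^+ 2 != mu ^+ 2 * z ->
  a *: w + b *: (w *m B x) = 0 -> w = 0.
Proof.
move=> Mx Tw la mu ne1 ne2 E; have [wx wW] := (tangent_iff w Mx).1 Tw.
have [x1 xz] := Mx.
apply: (shape_nondegenerate HP (la := la) (mu := mu) x1 wx wW); rewrite ?xz//.
rewrite -[RHS]E mul_shape scalerA -/mu scalerBr (scalerA mu z).
by rewrite [RHS]addrCA -scalerBl addrC; congr (_ + _ *: _); rewrite /la /mu; ring.
Qed.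

(** Zero is not a principal curvature of M: for a = 0 and b = 1 the two
    quantities of [normal_nondegenerate] reduce to - r^2 z (1 - z) = - 1. *)
Lemma shape_nonsingular x w : M x -> tangent M x w -> w *m B x = 0 -> w = 0.
Proof.
move=> Mx Tw E; apply: (normal_nondegenerate (a := 0) (b := 1) Mx Tw) => /=.
- rewrite [X in X != 0](_ : _ = - (r ^+ 2 * (z * (1 - z)))); last by ring.
  by rewrite nscale_sqr// oppr_eq0 oner_eq0.
- rewrite -subr_eq0 [X in X != 0](_ : _ = - (r ^+ 2 * (z * (1 - z)))); last by ring.
  by rewrite nscale_sqr// oppr_eq0 oner_eq0.
- by rewrite E scale0r scaler0 addr0.
Qed.

Lemma grad_linear q x : M x -> grad M (fun y => dotp y q) x = tproj nu x q.
Proof. by move=> Mx; apply: (grad_tproj MH Mx); exact: is_diff_linear. Qed.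

(** The Weingarten formula. *)
Lemma grad_normal q x : M x ->
  grad M (fun y => dotp (nu y) q) x = tproj nu x q *m B x.
Proof.
move=> Mx; apply: (gradE MH Mx).
  by apply: (tangent_mulB MH Mx); exact: (tangent_tproj MH).
move=> w Tw; rewrite (mdiffE (fun y _ => erefl) (is_diff_normal HP z_gt0 z_lt1 q x) Tw).
rewrite !(dotp_sym_mx MH) (dotp_tproj MH)//.
exact: (tangent_mulB MH Mx).
Qed.

Lemma critical_normal q :
  critical_set M (fun y => dotp (nu y) q) = critical_set M (fun y => dotp y q).
Proof.
apply/seteqP; split=> x [Mx E]; split=> //; move: E.
  by rewrite grad_normal// grad_linear//; apply: shape_nonsingular => //; exact: (tangent_tproj MH q Mx).
by rewrite grad_normal// grad_linear// => ->; rewrite mul0mx.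
Qed.

(** Where G vanishes, the derivative of B does not enter. *)
Lemma is_diff_mul_shape (G dG : 'rV[R]_(2 * l) -> 'rV[R]_(2 * l)) x :
  is_diff x G dG -> G x = 0 ->
  is_diff x (fun y => G y *m B y) (fun w => dG w *m B x).
Proof.
move=> DG G0.
have -> : (fun y => G y *m B y) = fun y => r *: (2 *: (\sum_a dotp (G y) (y *m P a) *: (y *m P a))
    + (\sum_a pform P y a *: (G y *m P a)) - z *: G y).
  by apply/funext => y; rewrite mul_shape [G y *m Wop P y]mul_cliff.
have Did := is_diff_id x.
have D1 a := is_diff_scalef
  (is_diff_dotp DG (is_diff_compmx (P a) Did)) (is_diff_compmx (P a) Did).
have D2 a := is_diff_scalef (is_diff_pform HP x a) (is_diff_compmx (P a) DG).
have D3 := is_diff_oppf (is_diff_scalef (is_diff_cstf z x) DG).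
have D := is_diff_scalef (is_diff_cstf r x) (is_diff_addf
  (is_diff_addf (is_diff_scalef (is_diff_cstf (2 : R) x) (is_diff_sumf D1))
    (is_diff_sumf D2)) D3).
apply: is_diff_ext D _ => w /=.
rewrite mul_shape !scale0r !addr0 mul_cliff G0; congr (_ *: (_ *: _ + _ - _)).
  by apply: eq_bigr => a _; rewrite !dotp0l scale0r !add0r.
by apply: eq_bigr => a _; rewrite mul0mx scaler0 addr0.
Qed.

(** The focal varieties of the family are p = 0 and |p| = |q|^2; q need not be
    a unit vector. *)
Definition nonfocal q := psqnorm P q != 0 /\ dotp q q ^+ 2 != psqnorm P q.

(** The first expression is the ratio p(q) / p(x). The second comes from |q|^4
    - |p(q)|^2 = (1 - z) (la^2 - mu^2 z)^2. *)
Lemma nonfocal_coef q x la mu : nonfocal q -> M x ->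
  q = la *: x + mu *: (x *m W x) ->
  la ^+ 2 + 2 * la * mu + mu ^+ 2 * z != 0 /\ la ^+ 2 != mu ^+ 2 * z.
Proof.
move=> [q0 q1] [x1 xz] qE; split.
  apply: contra q0 => /eqP k0.
  by rewrite qE (psqnorm_comb HP) x1 xz mulr1 k0 expr0n mul0r.
rewrite -subr_eq0; apply: contra q1 => /eqP k0.
rewrite -subr_eq0 qE (dotp_comb HP) (psqnorm_comb HP) x1 xz.
rewrite [X in X == 0](_ : _ = (1 - z) * (la ^+ 2 - mu ^+ 2 * z) ^+ 2); last by ring.
by rewrite k0 expr0n mulr0.
Qed.

Lemma nonfocal_nondegenerate q x w : nonfocal q ->
  M x -> tproj nu x q = 0 -> tangent M x w ->
  dotp q x *: w + dotp q (nu x) *: (w *m B x) = 0 -> w = 0.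
Proof.
move=> nq Mx Eq Tw E.
have [la [mu [qE laE muE]]] := tproj_eq0 Mx Eq.
have [ne1 ne2] := nonfocal_coef nq Mx qE.
by apply: (normal_nondegenerate Mx Tw _ _ E); rewrite -laE -muE.
Qed.

Lemma morse_linear q : nonfocal q -> morse M (fun y => dotp y q).
Proof.
move=> nq; split.
  by apply/smooth_onT/smooth_dotp; [exact: smooth_id | exact: smooth_cst].
move=> x [Mx]; rewrite grad_linear// => Eq w Tw Hw.
apply: (nonfocal_nondegenerate nq Mx Eq Tw).
apply: (tangent_eq0 Mx); first by apply: (tangentD_scale MH _ _ Mx) => //; exact: (tangent_mulB MH Mx).
move=> w' Tw'; have [J DJ JE] := is_diff_tproj_cst MH q Mx Tw.
have := Hw w' Tw'; rewrite /hessian (mdiffE _ DJ Tw); last by move=> y My; exact: grad_linear.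
by rewrite JE// => /eqP; rewrite oppr_eq0 => /eqP.
Qed.

Lemma smooth_pform a : smooth setT (fun y => pform P y a).
Proof.
by apply: smooth_dotp; [apply: smooth_compmx|]; exact: smooth_id.
Qed.

Lemma smooth_nfield : smooth setT nu.
Proof.
apply: smooth_scale; first exact: smooth_cst.
apply: smooth_sub; last by apply: smooth_scale; [exact: smooth_cst | exact: smooth_id].
rewrite (_ : (fun y => _) = fun y => \sum_a pform P y a *: (y *m P a)); last first.
  by apply/funext => y; rewrite mul_cliff.
apply: smooth_sum => a; apply: smooth_scale; first exact: smooth_pform.
by apply: smooth_compmx; exact: smooth_id.
Qed.

Lemma morse_normal q : nonfocal q -> morse M (fun y => dotp (nu y) q).
Proof.
move=> nq; split.
  by apply/smooth_onT/smooth_dotp; [exact: smooth_nfield | exact: smooth_cst].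
move=> x; rewrite critical_normal => -[Mx]; rewrite grad_linear// => Eq w Tw Hw.
have TB w' : tangent M x w' -> tangent M x (w' *m B x) by exact: (tangent_mulB MH Mx).
set y := dotp q x *: w + dotp q (nu x) *: (w *m B x).
have Ty : tangent M x y by apply: (tangentD_scale MH _ _ Mx) => //; exact: TB.
apply: (nonfocal_nondegenerate nq Mx Eq Tw); rewrite -/y.
apply: (shape_nonsingular Mx Ty); apply: (tangent_eq0 Mx); first exact: TB.
move=> w' Tw'; have [J DJ JE] := is_diff_tproj_cst MH q Mx Tw.
have := Hw w' Tw'.
rewrite /hessian (mdiffE _ (is_diff_mul_shape DJ Eq) Tw); last by move=> y' My'; exact: grad_normal.
rewrite !(dotp_sym_mx MH) JE => [/eqP|]; last exact: TB.
by rewrite oppr_eq0 => /eqP.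
Qed.

End FKMCritical.

(** * The eight critical points *)

Section FKMPoints.
Variables (R : realType) (l m : nat) (P : 'I_m.+1 -> 'M[R]_(2 * l)).
Hypothesis HP : clifford_system P.
Implicit Types (x y q w : 'rV[R]_(2 * l)).
Variable z : R.
Hypotheses (z_gt0 : 0 < z) (z_lt1 : z < 1).
Local Notation M := (psqnorm_level P z).
Local Notation W := (Wop P).
Let MH := FKM_sphere_hypersurface HP z_gt0 z_lt1.
Local Notation s := (Num.sqrt z).

Variables u v : 'rV[R]_(2 * l).
Hypotheses (u1 : dotp u u = 1) (v1 : dotp v v = 1).
Hypotheses (uP : u *m P ord0 = u) (vP : v *m P ord0 = - v).
Hypothesis uv : forall a, dotp (u *m P a) v = 0.

Definition frame_point (X Y : R) := X *: u + Y *: v.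
(** The unequal coefficients keep this point away from both focal varieties,
    where X^2 = Y^2 or X Y = 0. *)
Definition pole := frame_point 2 1.

Lemma dotp_frame_point X Y X' Y' :
  dotp (frame_point X Y) (frame_point X' Y') = X * X' + Y * Y'.
Proof.
have uv0 : dotp u v = 0 by rewrite -{1}uP uv.
by rewrite !dotp_lin (dotpC v u) u1 v1 uv0; ring.
Qed.

Lemma pform_frame_point X Y a :
  pform P (frame_point X Y) a = (a == ord0)%:R * (X ^+ 2 - Y ^+ 2).
Proof.
have pu : pform P u a = (a == ord0)%:R.
  by rewrite /pform -{2}uP (dotp_gen_gen HP) u1 mulr1.
have pv : pform P v a = - (a == ord0)%:R.
  have := dotp_gen_gen HP v a ord0; rewrite vP dotpNr v1 mulr1 => <-.
  by rewrite opprK.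
rewrite /pform /frame_point mulmxDl -!scalemxAl !dotp_lin.
rewrite -/(pform P u a) -/(pform P v a) pu pv uv.
by rewrite (dotp_gen HP) (dotpC v) uv; ring.
Qed.

Lemma psqnorm_axial x : (forall a, a != ord0 -> pform P x a = 0) ->
  psqnorm P x = pform P x ord0 ^+ 2.
Proof.
move=> H; rewrite /psqnorm (bigD1 ord0)//= big1 ?addr0// => a a0.
by rewrite H// expr0n.
Qed.

Lemma Wop_axial x : (forall a, a != ord0 -> pform P x a = 0) ->
  x *m W x = pform P x ord0 *: (x *m P ord0).
Proof.
move=> H; rewrite mul_cliff (bigD1 ord0)//= big1 ?addr0// => a a0.
by rewrite H// scale0r.
Qed.

Lemma frame_axial X Y a : a != ord0 -> pform P (frame_point X Y) a = 0.
Proof. by move=> /negbTE a0; rewrite pform_frame_point a0 mul0r. Qed.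

Lemma frame_point_level (X Y : R) : X ^+ 2 + Y ^+ 2 = 1 -> (X ^+ 2 - Y ^+ 2) ^+ 2 = z ->
  M (frame_point X Y).
Proof.
move=> E1 E2; split; first by rewrite dotp_frame_point -!expr2.
rewrite psqnorm_axial; last exact: frame_axial.
by rewrite pform_frame_point eqxx mul1r.
Qed.

Lemma pole_nonfocal : nonfocal P pole.
Proof.
rewrite /nonfocal.
rewrite psqnorm_axial; last exact: frame_axial.
rewrite dotp_frame_point pform_frame_point eqxx !mul1r.
split; first by rewrite [X in X != 0](_ : _ = 9%:R) ?pnatr_eq0//; ring.
by rewrite -subr_eq0 [X in X != 0](_ : _ = 16%:R) ?pnatr_eq0//; ring.
Qed.

Lemma frame_point_mulP0 X Y : frame_point X Y *m P ord0 = frame_point X (- Y).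
Proof. by rewrite /frame_point mulmxDl -!scalemxAl uP vP scalerN scaleNr. Qed.

(** If q is a combination of x and W(x) x, then p(q) is a nonzero multiple of
    p(x), so p(x) has the direction of p(q), W(x) is a multiple of P_0, and x
    is a combination of q and P_0 q. Conversely q then lies in the normal
    plane of x, which is spanned by x and P_0 x. *)
Lemma critical_pole :
  critical_set M (fun y => dotp y pole) =
  [set x | exists X Y, [/\ X ^+ 2 + Y ^+ 2 = 1, (X ^+ 2 - Y ^+ 2) ^+ 2 = z &
                         x = frame_point X Y]].
Proof.
apply/seteqP; split=> x.
  move=> [Mx]; rewrite (grad_linear HP z_gt0 z_lt1)// => Eq.
  have [x1 xz] := Mx.
  have [la [mu [qE _ _]]] := tproj_eq0 Mx Eq.
  have [k0 d0] := nonfocal_coef HP pole_nonfocal Mx qE.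
  rewrite -subr_eq0 in d0.
  have xax a : a != ord0 -> pform P x a = 0.
    move=> a0; have : (la ^+ 2 + 2 * la * mu + mu ^+ 2 * z) * pform P x a = 0.
      rewrite -(frame_axial 2 1 a0) -/pole qE (pform_comb HP) x1 xz mulr1.
      by [].
    by move/eqP; rewrite mulf_eq0 (negbTE k0) => /eqP.
  have xE : x = frame_point ((la ^+ 2 - mu ^+ 2 * z)^-1 * (la - mu * pform P x ord0) * 2)
                            ((la ^+ 2 - mu ^+ 2 * z)^-1 * (la + mu * pform P x ord0)).
    set p0 := pform P x ord0.
    have p0z : p0 ^+ 2 = z by rewrite -psqnorm_axial.
    have qE' : pole = la *: x + (mu * p0) *: (x *m P ord0).
      by rewrite {1}qE Wop_axial// scalerA.
    have qP : frame_point 2 (- 1) = la *: (x *m P ord0) + (mu * p0) *: x.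
      rewrite -frame_point_mulP0 -/pole qE' mulmxDl -!scalemxAl -mulmxA.
      by rewrite (cliff_sqr_gen HP) mulmx1.
    (* Solve q = (la + mu p_0 P_0) x for x, using P_0^2 = 1. *)
    have E : (la ^+ 2 - mu ^+ 2 * z) *: x = la *: pole - (mu * p0) *: frame_point 2 (- 1).
      rewrite qE' qP !scalerDr !scalerA -p0z (mulrC la (mu * p0)).
      by rewrite opprD addrA addrK -scalerBl; congr (_ *: _); ring.
    rewrite -[LHS](scalerK d0) E /pole /frame_point !scalerDr !scalerN !scalerDr !scalerA opprD addrACA.
    by rewrite -!scalerBl; congr (_ *: _ + _ *: _); ring.
  move: xE; set X := _ * 2; set Y := _ * _ => xE; exists X, Y.
  have := Mx; rewrite xE => -[]; rewrite psqnorm_axial; last exact: frame_axial.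
  by rewrite dotp_frame_point pform_frame_point eqxx mul1r -!expr2.
move=> [X [Y [E1 E2 ->]]]; have Mx := frame_point_level E1 E2.
split=> //; rewrite (grad_linear HP z_gt0 z_lt1)//.
set p := frame_point X Y in Mx *; set t := tproj _ _ _.
have Tt : tangent M p t by exact: (tangent_tproj MH).
have [tp tW] := (tangent_iff HP z_gt0 z_lt1 t Mx).1 Tt.
(* It suffices that the tangential part t of q is orthogonal to x and P_0 x, which span q. *)
have XY0 : X ^+ 2 - Y ^+ 2 != 0.
  by apply: contraTneq z_gt0 => E; rewrite -E2 E expr0n ltxx.
have tpP : dotp t (p *m P ord0) = 0.
  move: tW; rewrite Wop_axial => [|a]; last exact: frame_axial.
  rewrite dotpZr pform_frame_point eqxx mul1r => /eqP.
  by rewrite mulf_eq0 (negbTE XY0) => /eqP.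
have Xne : X != 0.
  apply/eqP => X0; have Y1 : Y ^+ 2 = 1 by rewrite -E1 X0; ring.
  by move: E2 z_lt1; rewrite Y1 X0 => <-; rewrite expr0n sub0r sqrrN expr1n ltxx.
have Yne : Y != 0.
  apply/eqP => Y0; have X1 : X ^+ 2 = 1 by rewrite -E1 Y0; ring.
  by move: E2 z_lt1; rewrite X1 Y0 => <-; rewrite expr0n subr0 expr1n ltxx.
have qE : pole = (X^-1 + (2 * Y)^-1) *: p + (X^-1 - (2 * Y)^-1) *: (p *m P ord0).
  rewrite frame_point_mulP0 /p /frame_point !scalerDr !scalerA addrACA.
  rewrite -[_ *: u + _]scalerDl -[_ *: v + _]scalerDl.
  by congr (_ *: _ + _ *: _); field; rewrite Xne Yne.
apply/eqP; rewrite -dotp_eq0 (dotp_tproj MH pole Mx Tt) dotpC qE dotpDr !dotpZr.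
by rewrite tp tpP !mulr0 addr0.
Qed.

Lemma sqrt_level : [/\ 0 < s, s < 1 & s ^+ 2 = z].
Proof.
split; first by rewrite sqrtr_gt0.
  by rewrite -sqrtr1 ltr_sqrt.
by rewrite sqr_sqrtr// ltW.
Qed.

Local Notation al := (Num.sqrt ((1 + s) / 2)).
Local Notation be := (Num.sqrt ((1 - s) / 2)).

(** The two absolute values that X and Y can take: half angle formulas for the
    cosine sqrt z. *)
Lemma half_angles : [/\ 0 < be, be < al, al ^+ 2 = (1 + s) / 2 & be ^+ 2 = (1 - s) / 2].
Proof.
have [s0 s1 _] := sqrt_level.
split; first by rewrite sqrtr_gt0; lra.
- by rewrite ltr_sqrt; lra.
- by rewrite sqr_sqrtr//; lra.
- by rewrite sqr_sqrtr//; lra.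
Qed.

(** Two signs, and the choice of which of X and Y is larger. *)
Definition octant (e : bool * bool * bool) : 'rV[R]_(2 * l) :=
  frame_point ((-1) ^+ e.1.1 * (if e.2 then al else be))
              ((-1) ^+ e.1.2 * (if e.2 then be else al)).

Lemma frame_point_inj X Y X' Y' :
  frame_point X Y = frame_point X' Y' -> X = X' /\ Y = Y'.
Proof.
move=> E; split.
  have := congr1 (fun w => dotp w (frame_point 1 0)) E.
  by rewrite !dotp_frame_point !mulr1 !mulr0 !addr0.
have := congr1 (fun w => dotp w (frame_point 0 1)) E.
by rewrite !dotp_frame_point !mulr1 !mulr0 !add0r.
Qed.

Lemma octant_inj : injective octant.
Proof.
have [be0 beal _ _] := half_angles; have al0 := lt_trans be0 beal.
have sg (b b' : bool) (c c' : R) : 0 < c -> 0 < c' ->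
    (-1) ^+ b * c = (-1) ^+ b' * c' -> b = b' /\ c = c'.
  move=> c0 c'0; case: b b' => -[]; rewrite ?expr0 ?expr1 ?mulN1r ?mul1r => E;
    split=> //; lra.
move=> [[e1 e2] e3] [[e1' e2'] e3'] /frame_point_inj[/= /sg E1 /sg E2].
have [||-> E3] := E1; [by case: (e3)|by case: (e3')|].
have [||-> _] := E2; [by case: (e3)|by case: (e3')|].
congr (_, _, _); move: E3; clear E1 E2; case: e3; case: e3' => //= E3; lra.
Qed.

Lemma range_octant : range octant =
  [set x | exists X Y, [/\ X ^+ 2 + Y ^+ 2 = 1, (X ^+ 2 - Y ^+ 2) ^+ 2 = z &
                         x = frame_point X Y]].
Proof.
have [s0 s1 s2] := sqrt_level; have [be0 beal al2 be2] := half_angles.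
have al0 := lt_trans be0 beal.
apply/seteqP; split=> [x [[[e1 e2] e3] _ <-]|x [X [Y [E1 E2 ->]]]].
  do 2 eexists; split; last by [].
    by rewrite !exprMn !sqrr_sign !mul1r; case: e3; rewrite /= al2 be2; lra.
  rewrite !exprMn !sqrr_sign !mul1r -[RHS]s2.
  by case: e3; rewrite /= al2 be2; field.
have sgE (c t : R) : 0 < c -> t ^+ 2 = c ^+ 2 -> t = (-1) ^+ (t < 0)%R * c.
  move=> c0 /eqP; rewrite eqf_sqr => /orP[] /eqP ->.
    by rewrite (lt_gtF c0) mul1r.
  by rewrite oppr_lt0 c0 mulN1r.
have : (X ^+ 2 - Y ^+ 2 == s) || (X ^+ 2 - Y ^+ 2 == - s).
  by rewrite -eqf_sqr E2 s2.
case/orP => /eqP E3; [exists (X < 0, Y < 0, true)|exists (X < 0, Y < 0, false)] => //;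
  by congr frame_point; rewrite /= -sgE// ?al2 ?be2; lra.
Qed.

Lemma card_critical_pole : (critical_set M (fun y => dotp y pole) #= `I_8)%card.
Proof.
rewrite critical_pole -range_octant.
have -> : 8%N = #|{: bool * bool * bool}| by rewrite !card_prod !card_bool.
exact: (card_range_finType octant_inj).
Qed.

End FKMPoints.

(** * The quadratic function and its focal submanifolds *)

Section RowMaps.
Variable R : realType.

Lemma is_diff_row (V : normedModType R) n (f df : 'I_n -> V -> R) x :
  (forall j, is_diff x (f j) (df j)) ->
  is_diff x (fun y => \row_j f j y) (fun v => \row_j df j v).
Proof.
move=> D.
have rowE (h : 'I_n -> V -> R) :
    (fun y => \row_j h j y) = fun y => \sum_j h j y *: (delta_mx 0 j : 'rV[R]_n).
  apply/funext => y; rewrite [LHS]row_sum_delta.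
  by apply: eq_bigr => j _; rewrite mxE.
rewrite !rowE.
have Dj j := is_diff_scalef (D j) (is_diff_cstf (delta_mx 0 j : 'rV[R]_n) x).
apply: is_diff_ext (is_diff_sumf Dj) _ => v.
by apply: eq_bigr => j _; rewrite scaler0 add0r.
Qed.

End RowMaps.

Section FKMSubmanifold.
Variables (R : realType) (l m : nat) (P : 'I_m.+1 -> 'M[R]_(2 * l)).
Hypothesis HP : clifford_system P.
Implicit Types (x y q w : 'rV[R]_(2 * l)).

(** The gradients of the m + 2 equations are multiples of P_0 x, ..., P_m x
    and x, which are independent when p_0^2 <> 1. The last coordinate of the
    defining map is the equation of the sphere. *)
Lemma axial_level_submanifold (d : nat) (h k : 'rV[R]_(2 * l) -> R)
    (S : set 'rV[R]_(2 * l)) :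
  (2 * l - d)%N = m.+2 -> (d <= 2 * l)%N -> S !=set0 -> smooth setT h ->
  (forall x, is_diff x h (fun v => k x * dotp v (x *m P ord0))) ->
  (forall x, S x <-> [/\ dotp x x = 1, forall a, a != ord0 -> pform P x a = 0 & h x = 0]) ->
  (forall x, S x -> k x != 0 /\ pform P x ord0 ^+ 2 != 1) ->
  submanifold d S.
Proof.
move=> eD dN S0 sh Dh SE Sreg; split=> // x0 _; exists setT.
move: eD; move: (2 * l - d)%N => D eD; subst D.
pose G (j : 'I_m.+2) y : R := match unlift ord_max j with
  | Some a => if a == ord0 then h y else pform P y a
  | None => dotp y y - 1 end.
pose dG y (j : 'I_m.+2) v : R := match unlift ord_max j with
  | Some a => if a == ord0 then k y * dotp v (y *m P ord0) else 2 * dotp v (y *m P a)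
  | None => 2 * dotp v y end.
have DG y j : is_diff y (G j) (dG y j).
  rewrite /G /dG; case: unliftP => [a _|_].
    by case: eqP => // _; exact: is_diff_pform.
  have D1 := is_diff_dotp (is_diff_id y) (is_diff_id y).
  apply: is_diff_ext (is_diff_addf D1 (is_diff_cstf (-1 : R) y)) _ => v /=.
  by rewrite addr0 (dotpC y) mulrDl mul1r.
exists (fun y => \row_j G j y); split=> //; first exact: openT.
- apply: smooth_row => j; rewrite /G; case: unliftP => [a _|_].
    by case: eqP => // _; exact: smooth_pform.
  by apply: smooth_sub; [apply: smooth_dotp; exact: smooth_id | exact: smooth_cst].
- move=> y _; rewrite SE; split=> [[y1 ya hy]|/rowP E].
    apply/rowP => j; rewrite !mxE /G; case: unliftP => [a _|_].
      by case: eqP => // /eqP; exact: ya.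
    by rewrite y1 subrr.
  have Ea a := E (lift ord_max a).
  split.
  + by have := E ord_max; rewrite !mxE /G unlift_none => /eqP; rewrite subr_eq0 => /eqP.
  + by move=> a a0; have := Ea a; rewrite !mxE /G liftK (negbTE a0).
  + by have := Ea ord0; rewrite !mxE /G liftK eqxx.
- move=> y _ Sy w; have [k0 p1] := Sreg y Sy; have [y1 ya hy] := (SE y).1 Sy.
  set p := pform P y ord0 in p1.
  (* v = sum_a c_a P_a y + t y; t solves the last equation once the c_a are eliminated. *)
  pose t := (w 0 ord_max / 2 - p * w 0 (lift ord_max ord0) / k y) / (1 - p ^+ 2).
  pose c (a : 'I_m.+1) := if a == ord0 then w 0 (lift ord_max ord0) / k y - t * p
    else w 0 (lift ord_max a) / 2.
  have vP b : dotp (y *m cliff P c + t *: y) (y *m P b) = c b + t * pform P y b.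
    rewrite dotpDl dotpZl (dotpC (y *m cliff P c)) (dotp_gen_cliff HP) y1 mulr1.
    by rewrite (dotpC y).
  have vy : dotp (y *m cliff P c + t *: y) y = c ord0 * p + t.
    rewrite dotpDl dotpZl y1 mulr1 dotp_mul_cliff (bigD1 ord0)//= big1 ?addr0// => a a0.
    by rewrite -/(pform P y a) ya// mulr0.
  exists (y *m cliff P c + t *: y).
  rewrite (is_diff_derive _ (is_diff_row (DG y))).
  apply/rowP => j; rewrite mxE /dG; case: unliftP => [a ->|->].
    case: eqP => [->|/eqP a0]; rewrite vP.
      by rewrite /c eqxx -/p subrK; field.
    by rewrite ya// /c (negbTE a0); field.
  rewrite vy /c eqxx /t; field.
  by rewrite k0 andbT subr_eq0 eq_sym.
Qed.

End FKMSubmanifold.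

Section FKMQuadratic.
Variables (R : realType) (l m : nat) (P : 'I_m.+1 -> 'M[R]_(2 * l)).
Hypothesis HP : clifford_system P.
Implicit Types (x y q w : 'rV[R]_(2 * l)).
Variable z : R.
Hypotheses (z_gt0 : 0 < z) (z_lt1 : z < 1).
Local Notation M := (psqnorm_level P z).
Local Notation r := (nscale z).
Local Notation nu := (nfield P z).
Let MH := FKM_sphere_hypersurface HP z_gt0 z_lt1.
Local Notation s := (Num.sqrt z).
Local Notation phi := (fun y => pform P y ord0).

Lemma grad_pform x : M x -> grad M phi x = tproj nu x (2 *: (x *m P ord0)).
Proof. by move=> Mx; apply: (grad_tproj MH Mx); exact: is_diff_pform_grad. Qed.

Lemma sqr_norm_tproj x g : M x ->
  dotp (tproj nu x g) (tproj nu x g) = dotp g g - dotp g x ^+ 2 - dotp g (nu x) ^+ 2.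
Proof.
move=> Mx; rewrite (dotp_tproj MH g Mx); last exact: (tangent_tproj MH).
by rewrite /tproj; move: (nu x) => n; rewrite !dotp_lin -!expr2.
Qed.

(** From |P_0 x| = 1, <P_0 x, x> = p_0 and <P_0 x, nu>^2 = p_0^2 (1 - z) / z.
    *)
Lemma sqr_norm_grad_pform x : M x ->
  dotp (grad M phi x) (grad M phi x) = 4 * (1 - phi x ^+ 2 / z).
Proof.
move=> Mx; have [x1 xz] := Mx; rewrite grad_pform// sqr_norm_tproj//.
have -> : dotp (2 *: (x *m P ord0)) (nu x) = 2 * (r * (1 - z)) * phi x.
  rewrite nfieldE !dotpDr !dotpZl !dotpZr -/(pform P x ord0) (dotp_gen_cliff HP) x1.
  by ring.
rewrite !dotpZl !dotpZr (dotp_gen_gen HP) eqxx mul1r x1 -/(pform P x ord0).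
have rz : (r * (1 - z)) ^+ 2 = (1 - z) / z.
  apply: (mulIf (lt0r_neq0 z_gt0)); rewrite divfK ?gt_eqF//.
  by rewrite -[RHS]mul1r -[X in _ = X * _](nscale_sqr z_gt0 z_lt1); ring.
by rewrite [X in _ - X]exprMn [(2 * (r * _)) ^+ 2]exprMn rz; field; rewrite gt_eqF.
Qed.

Lemma pform_level_le x : M x -> phi x ^+ 2 <= z.
Proof.
move=> [_ <-]; rewrite /psqnorm (bigD1 ord0)//= lerDl.
by apply: sumr_ge0 => a _; exact: sqr_ge0.
Qed.

(** p_0^2 is one of the summands of |p|^2 = z. *)
Lemma level_pform_extremal x : M x /\ phi x ^+ 2 = z <->
  [/\ dotp x x = 1, forall a, a != ord0 -> pform P x a = 0 & phi x ^+ 2 = z].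
Proof.
split=> [[[x1 xz] pz]|[x1 xa pz]]; last first.
  by split=> //; split=> //; rewrite psqnorm_axial.
split=> // a a0; move: xz; rewrite /psqnorm (bigD1 ord0)//= pz => /eqP.
rewrite -subr_eq0 addrAC subrr add0r psumr_eq0 => [/allP H|b _]; last exact: sqr_ge0.
by have := H a (mem_index_enum a); rewrite a0 /= sqrf_eq0 => /eqP.
Qed.

Lemma critical_pform : critical_set M phi = [set x | M x /\ phi x ^+ 2 = z].
Proof.
apply/seteqP; split=> x [Mx]; have := sqr_norm_grad_pform Mx.
  move=> E E0; split=> //; move: E; rewrite E0 dotp0l => /esym/eqP.
  rewrite mulf_eq0 pnatr_eq0 /= subr_eq0 eq_sym => /eqP H.
  by rewrite -[RHS]mul1r -H divfK// gt_eqF.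
move=> + E; rewrite E divff ?gt_eqF// subrr mulr0 => /eqP.
by rewrite dotp_eq0 => /eqP.
Qed.

Hypotheses (m_gt0 : (0 < m)%N) (ml : (m + 1 < l)%N).

(** Attained on the circle spanned by u and v, where p_0 = X^2 - Y^2. *)
Lemma ex_pform_extremal e : e ^+ 2 = z -> exists x, M x /\ phi x = e.
Proof.
move=> ez; have [u [v [u1 v1 uP vP uv]]] := ex_clifford_frame HP m_gt0 ml.
have e1 : -1 < e < 1 by rewrite -ltr_norml -ltr_sqr ?nnegrE// real_normK ?num_real// expr1n ez.
pose X := Num.sqrt ((1 + e) / 2); pose Y := Num.sqrt ((1 - e) / 2).
have X2 : X ^+ 2 = (1 + e) / 2 by rewrite sqr_sqrtr//; lra.
have Y2 : Y ^+ 2 = (1 - e) / 2 by rewrite sqr_sqrtr//; lra.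
have E : X ^+ 2 - Y ^+ 2 = e by rewrite X2 Y2; field.
exists (frame_point u v X Y); split.
  by apply: (frame_point_level HP u1 v1 uP vP uv); [rewrite X2 Y2; field | rewrite E].
by rewrite (pform_frame_point HP u1 v1 uP vP uv) eqxx mul1r.
Qed.

Lemma focal_max_pform : focal_max M phi = [set x | M x /\ phi x = s].
Proof.
have [s0 s1 s2] := sqrt_level z_gt0 z_lt1.
have le x : M x -> phi x <= s.
  move=> Mx; apply: le_trans (ler_norm _) _.
  by rewrite -ler_sqr ?nnegrE ?(ltW s0)// real_normK ?num_real// s2; exact: pform_level_le.
apply/seteqP; split=> x [Mx]; last by move=> E; split=> // y /le; rewrite E.
move=> H; split=> //; apply/eqP; rewrite eq_le le//=.
by have [y [My <-]] := ex_pform_extremal s2; exact: H.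
Qed.

Lemma focal_min_pform : focal_min M phi = [set x | M x /\ phi x = - s].
Proof.
have [s0 s1 s2] := sqrt_level z_gt0 z_lt1.
have ge x : M x -> - s <= phi x.
  move=> Mx; rewrite lerNl; apply: le_trans (ler_norm _) _; rewrite normrN.
  by rewrite -ler_sqr ?nnegrE ?(ltW s0)// real_normK ?num_real// s2; exact: pform_level_le.
apply/seteqP; split=> x [Mx]; last by move=> E; split=> // y /ge; rewrite E.
move=> H; split=> //; apply/eqP; rewrite eq_le ge//= andbT.
have ms : (- s) ^+ 2 = z by rewrite sqrrN.
by have [y [My <-]] := ex_pform_extremal ms; exact: H.
Qed.

Lemma focal_dim : (2 * l - (2 * l - 2 - m))%N = m.+2.
Proof. by rewrite -subnDA add2n subKn// mul2n -addnn; lia. Qed.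

Lemma focal_pform_submanifold e : e ^+ 2 = z ->
  submanifold (2 * l - 2 - m) [set x | M x /\ phi x = e].
Proof.
move=> ez; have [x0 x0P] := ex_pform_extremal ez.
apply: (axial_level_submanifold HP (h := fun y => phi y - e) (k := fun=> 2)).
- exact: focal_dim.
- lia.
- by exists x0.
- by apply: smooth_sub; [exact: smooth_pform | exact: smooth_cst].
- move=> x; apply: is_diff_ext (is_diff_addf (is_diff_pform HP x ord0) (is_diff_cstf (- e) x)) _ => w.
  by rewrite addr0.
- move=> x; split=> [[Mx E]|[x1 xa /subr0_eq E]].
    have [|x1 xa _] := (level_pform_extremal x).1; first by rewrite E.
    by split=> //; rewrite E subrr.
  by split=> //; apply: (proj1 ((level_pform_extremal x).2 _)); split=> //; rewrite E.
- move=> x [_ ->]; rewrite ez pnatr_eq0; split=> //.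
  by rewrite lt_eqF.
Qed.

Lemma critical_pform_submanifold : submanifold (2 * l - 2 - m) (critical_set M phi).
Proof.
have [s0 s1 s2] := sqrt_level z_gt0 z_lt1; have [x0 [Mx0 x0s]] := ex_pform_extremal s2.
rewrite critical_pform.
apply: (axial_level_submanifold HP (h := fun y => phi y * phi y - z) (k := fun x => 4 * phi x)).
- exact: focal_dim.
- lia.
- by exists x0; split=> //; rewrite x0s.
- apply: smooth_sub; last exact: smooth_cst.
  by apply: smooth_mul; exact: smooth_pform.
- move=> x; have D := is_diff_pform HP x ord0.
  apply: is_diff_ext (is_diff_addf (is_diff_mulf D D) (is_diff_cstf (- z) x)) _ => w.
  by rewrite addr0; ring.
- move=> x; rewrite -expr2; split=> [/level_pform_extremal[x1 xa E]|[x1 xa E]].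
    by split=> //; rewrite E subrr.
  by apply/level_pform_extremal; split=> //; exact: subr0_eq.
- move=> x [_ E]; rewrite E; split; last by rewrite lt_eqF.
  rewrite mulf_neq0 ?pnatr_eq0//; apply: contraTneq z_gt0 => E0.
  by rewrite -E E0 expr0n ltxx.
Qed.

End FKMQuadratic.

(** * The minimal level and the three eigenfunctions *)

Section FKMMinimal.
Variables (R : realType) (l m : nat) (P : 'I_m.+1 -> 'M[R]_(2 * l)).
Hypothesis HP : clifford_system P.

(** On the unit sphere F = 1 - 2 |p|^2. *)
Lemma FKM_hypersurfaceE c : FKM_hypersurface P c = psqnorm_level P ((1 - c) / 2).
Proof.
apply/seteqP; split=> x [x1].
  by rewrite /FKM_polynomial x1 expr1n -/(psqnorm P x) => E; split=> //; rewrite -E; field.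
by move=> E; split=> //; rewrite /FKM_polynomial x1 expr1n -/(psqnorm P x) E; field.
Qed.

Hypotheses (m_gt0 : (0 < m)%N) (ml : (m + 1 < l)%N).

(** The hypothesis is tested on the globally defined normal field. *)
Lemma minimal_level z : 0 < z -> z < 1 ->
  minimal_hypersurface_of_sphere (psqnorm_level P z) -> m%:R = z * (l%:R - 1).
Proof.
move=> z0 z1 [_ [_ [x Mx] _] minM].
have MH := FKM_sphere_hypersurface HP z0 z1.
have unu : unit_normal_field (psqnorm_level P z) setT (nfield P z).
  split; first by apply: smooth_onT; exact: smooth_nfield.
  move=> y My _; split; first exact: (sh_nunit MH).
    by rewrite dotpC; exact: (sh_orth MH).
  by move=> v /(sh_tangent MH _ My)[_ vn]; rewrite dotpC.
have := minM _ _ openT unu x Mx I; rewrite (mean_curvatureE MH)//.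
rewrite (ttrace_shape HP z0 z1 m_gt0 Mx) => /eqP.
rewrite oppr_eq0 !mulf_eq0 pnatr_eq0 (negbTE (nscale_neq0 z0 z1)) /= subr_eq0.
by move/eqP.
Qed.

End FKMMinimal.

Theorem theorem1p1 (R : realType) (l m : nat) (P : 'I_m.+1 -> 'M[R]_(2 * l))
    (c0 : R) :
  let n := (2 * l - 2)%N in
  let M := FKM_hypersurface P c0 in
  (0 < m)%N -> (m + 1 < l)%N ->
  clifford_system P ->
  -1 < c0 < 1 ->
  minimal_hypersurface_of_sphere M ->
  exists phi1 phi2 phi3 : 'rV[R]_(2 * l) -> R,
    [/\ [/\ eigenfunction M n%:R phi1,
            eigenfunction M (2 * n)%:R phi2 &
            eigenfunction M (3 * n)%:R phi3],
        morse M phi1 /\ (critical_set M phi1 #= `I_8)%card,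
        [/\ isoparametric M phi2,
            critical_set M phi2 = focal_max M phi2 `|` focal_min M phi2,
            submanifold (n - m) (critical_set M phi2),
            (submanifold (n - m) (focal_max M phi2) /\
             submanifold (n - m) (focal_min M phi2)) &
            (1 <= m < n)%N] &
        morse M phi3 /\ (critical_set M phi3 #= `I_8)%card].
Proof.
move=> n M m0 ml HP /andP[c0_gt c0_lt].
rewrite /M FKM_hypersurfaceE; set z := (1 - c0) / 2 => minM.
have z0 : 0 < z by rewrite /z; lra.
have z1 : z < 1 by rewrite /z; lra.
have level := minimal_level HP m0 z0 z1 minM.
have [s0 s1 s2] := sqrt_level z0 z1.
have [be0 beal al2 be2] := half_angles z0 z1.
move: s0 s1 s2 be0 beal al2 be2; set s := Num.sqrt z.
set al := Num.sqrt ((1 + s) / 2); set be := Num.sqrt ((1 - s) / 2).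
move=> s0 s1 s2 be0 beal al2 be2; have al0 := lt_trans be0 beal.
have [u [v [u1 v1 uP vP uv]]] := ex_clifford_frame HP m0 ml.
have nE : n%:R = 2 * (l%:R - 1) :> R.
  by rewrite /n natrB ?natrM; [ring | lia].
have nq := pole_nonfocal HP u1 v1 uP vP uv.
have ms2 : (- s) ^+ 2 = z by rewrite sqrrN.
have [xp [Mxp xps]] := ex_pform_extremal HP z1 m0 ml s2.
have [xm [Mxm xms]] := ex_pform_extremal HP z1 m0 ml ms2.
have MH := FKM_sphere_hypersurface HP z0 z1.
exists (fun y => dotp y (pole u v)), (fun y => pform P y ord0),
  (fun y => dotp (nfield P z y) (pole u v)).
have level_pt Y : Y ^+ 2 = be ^+ 2 ->
    psqnorm_level P z (frame_point u v al Y).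
  move=> YE; apply: (frame_point_level HP u1 v1 uP vP uv).
    by rewrite YE al2 be2; field.
  by rewrite YE al2 be2 -[RHS]s2; field.
split.
- split; split.
  + by apply: smooth_onT; apply: smooth_dotp; [exact: smooth_id|exact: smooth_cst].
  + exists (frame_point u v al be); first exact: level_pt.
    by rewrite (dotp_frame_point u1 v1 uP uv) gt_eqF//; lra.
  + by move=> x Mx; rewrite (laplacian_linear HP z0 z1 m0 level _ Mx) nE; ring.
  + by apply: smooth_onT; exact: smooth_pform.
  + by exists xp => //; rewrite xps gt_eqF.
  + move=> x Mx; rewrite (laplacian_pform HP z0 z1 m0 level _ Mx) natrM nE; ring.
  + apply: smooth_onT.
    by apply: smooth_dotp; [exact: smooth_nfield|exact: smooth_cst].
  + exists (frame_point u v al (- be)); first by apply: level_pt; rewrite sqrrN.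
    rewrite nfieldE Wop_axial => [|a]; last exact: (frame_axial HP u1 v1 uP vP uv).
    rewrite (pform_frame_point HP u1 v1 uP vP uv) eqxx mul1r sqrrN al2 be2.
    rewrite (frame_point_mulP0 uP vP) opprK dotpDl !dotpZl.
    rewrite !(dotp_frame_point u1 v1 uP uv).
    have := nscale_neq0 z0 z1; set r := nscale _ => r0; rewrite -s2.
    (* The opposite sign of the second coordinate makes both terms positive. *)
    rewrite [X in X != 0](_ : _ = r * s * (2 * al * (1 - s) + be * (1 + s))); last by field.
    rewrite !mulf_neq0//; [by rewrite gt_eqF |].
    by rewrite gt_eqF// addr_gt0// !mulr_gt0//; lra.
  + move=> x Mx; rewrite (laplacian_normal HP z0 z1 m0 level _ Mx) natrM nE; ring.
- split; first exact: (morse_linear HP z0 z1 nq).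
  exact: (card_critical_pole HP z0 z1 u1 v1 uP vP uv).
- split.
  + split; first by apply: smooth_onT; exact: smooth_pform.
      by exists xp, xm; split=> //; rewrite xps xms; apply/eqP; lra.
    exists (fun t => - (4 * (l%:R - 1)) * t), (fun t => 4 * (1 - t * t / z)); split.
    * by move=> t; apply: cvgM; [exact: cvg_cst | exact: cvg_id].
    * apply: smooth_mul; first exact: smooth_cst.
      apply: smooth_sub; first exact: smooth_cst.
      by apply: smooth_mul; [apply: smooth_mul; exact: smooth_id | exact: smooth_cst].
    * move=> x Mx; split; last exact: (laplacian_pform HP z0 z1 m0 level _ Mx).
      by rewrite (sqr_norm_grad_pform HP z0 z1 Mx) expr2.
  + rewrite (critical_pform HP z0 z1) (focal_max_pform HP z0 z1 m0 ml).
    rewrite (focal_min_pform HP z0 z1 m0 ml); apply/seteqP; split=> x.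
      move=> [Mx E2].
      have : (pform P x ord0 == s) || (pform P x ord0 == - s) by rewrite -eqf_sqr E2 s2.
      by case/orP => /eqP E; [left|right].
    by case=> -[Mx E]; split=> //; rewrite E ?ms2.
  + exact: (critical_pform_submanifold HP z0 z1 m0 ml).
  + rewrite (focal_max_pform HP z0 z1 m0 ml) (focal_min_pform HP z0 z1 m0 ml).
    by split; apply: (focal_pform_submanifold HP z1 m0 ml).
  + by apply/andP; split=> //; rewrite /n; lia.
- split; first exact: (morse_normal HP z0 z1 nq).
  rewrite (critical_normal HP z0 z1).
  exact: (card_critical_pole HP z0 z1 u1 v1 uP vP uv).
Qed.
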